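(* Let $X$ be an infinite-dimensional complex Banach space and let $T$ be a bounded linear operator on $X$. Then $T$ is left generalized Drazin invertible if and only if $T$ admits a generalized Kato decomposition $(M,N)$ and satisfies one of the following assertions, which are equivalent to each other for an operator $T$ with a generalized Kato decomposition $(M,N)$: (i) $T$ has the SVEP at $0$; (ii) $T_M$ has the SVEP at $0$; (iii) $T_M$ is injective; (iv) $H_0(T)=N$; (v) $H_0(T)$ is closed; (vi) $K(T)\cap H_0(T)=\{0\}$; (vii) $K(T)\cap H_0(T)$ is closed.
   Context: $\mathcal{L}(X)$ is the algebra of bounded linear operators on $X$; $T_M$ denotes the restriction of $T$ to a $T$-invariant closed subspace $M$, regarded as an operator on $M$. The quasinilpotent part of $T$ is $H_0(T)=\{x\in X:\lim_{n\to\infty}\|T^nx\|^{1/n}=0\}$. The analytical core $K(T)$ of $T$ is the set of all $x\in X$ for which there exist a sequence $(x_n)_{n\ge1}$ in $X$ and a constant $\delta>0$ such that $Tx_1=x$, $Tx_{n+1}=x_n$ and $\|x_n\|\le\delta^n\|x\|$ for all $n\in\mathbb{N}$. $T\in\mathcal{L}(X)$ is left generalized Drazin invertible if $H_0(T)$ is closed and there is a closed subspace $M$ of $X$ with $X=M\oplus H_0(T)$, $T(M)\subset M$ and $T(M)$ closed. An operator $S$ is semi-regular if its range $R(S)$ is closed and $N(S^n)\subseteq R(S)$ for all $n\in\mathbb{N}$, where $N(\cdot)$ is the null space. A pair $(M,N)$ of closed subspaces is a generalized Kato decomposition (GKD) of $T$ if $X=M\oplus N$, $T(M)\subset M$, $T(N)\subset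 N$, $T_M$ is semi-regular and $T_N$ is quasinilpotent. An operator $S$ on a Banach space $Y$ has the single-valued extension property (SVEP) at $\lambda_0\in\mathbb{C}$ if for every connected open neighborhood $\mathcal{U}$ of $\lambda_0$ the only analytic function $f:\mathcal{U}\to Y$ satisfying $(\lambda I-S)f(\lambda)=0$ for all $\lambda\in\mathcal{U}$ is $f\equiv 0$. *)

(* Defs.v *)
From HB Require Import structures.
From mathcomp Require Import all_boot all_order all_algebra.
From mathcomp Require Import all_classical all_reals all_analysis.
From mathcomp Require Export complex.

Set Implicit Arguments.
Unset Strict Implicit.
Unset Printing Implicit Defensive.

Import Order.TTheory GRing.Theory Num.Theory.
Export numFieldNormedType.Exports.

Local Open Scope classical_set_scope.
Local Open Scope ring_scope.

HB.instance Definition _ (R : realType) := NormedModule.copy R[i] R[i]^o.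

(* A linear subspace of X is a bundled predicate [M : submodClosed X]; the next
   type makes it a normed space of its own, with the norm inherited from X. *)
Section SubspaceType.
Context {K : numFieldType} {X : normedModType K}.
Variable M : submodClosed X.

Record subspace_type := SubspaceType {
  subspace_val : X;
  _ : subspace_val \in M }.

HB.instance Definition _ := [isSub for subspace_val].
HB.instance Definition _ := [Choice of subspace_type by <:].
HB.instance Definition _ := [SubChoice_isSubLmodule of subspace_type by <:].

Let subspace_norm (x : subspace_type) : K := `|val x|.

Let subspace_ler_normD x y :
  subspace_norm (x + y) <= subspace_norm x + subspace_norm y.
Proof. exact: ler_normD. Qed.

Let subspace_normrZ (l : K) x :
  subspace_norm (l *: x) = `|l| * subspace_norm x.
Proof. exact: normrZ. Qed.

Let subspace_normr0_eq0 x : subspace_norm x = 0 -> x = 0.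
Proof. by move=> /normr0_eq0 x0; apply: val_inj. Qed.

HB.instance Definition _ := Lmodule_isNormed.Build K subspace_type
  subspace_ler_normD subspace_normrZ subspace_normr0_eq0.

End SubspaceType.

Section SubspaceOps.
Context {K : numFieldType} {X : normedModType K}.
Implicit Types (M N : submodClosed X) (T : X -> X).

Definition closed_subspace M : Prop := closed [set x | x \in M].

Definition invariant_subspace T M : Prop := forall x, x \in M -> T x \in M.

(* The operator T_M on M.  The default value 0 is taken only at points x of M
   with T x outside M, hence never when M is T-invariant. *)
Definition restr_op T M : subspace_type M -> subspace_type M :=
  fun x => insubd 0 (T (val x)).

Definition direct_sum (A B : set X) : Prop :=
  (forall x, exists a b, [/\ A a, B b & x = a + b]) /\ A `&` B = [set 0].

Definition infinite_dimensional (V : normedModType K) : Prop :=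
  ~ exists n (e : 'I_n -> V),
      forall x, exists c : 'I_n -> K, x = \sum_(i < n) c i *: e i.

End SubspaceOps.

Arguments restr_op {K X} T M _.
Arguments infinite_dimensional {K} V.

Section Operators.
Context {R : realType} {Y : normedModType R[i]}.
Implicit Types S : Y -> Y.

(* The norm of a normed space over R[i] takes its (real) values in R[i]. *)
Definition rnorm (x : Y) : R := complex.Re `|x|.

Definition opnorm S : R := sup [set rnorm (S x) | x in [set x | rnorm x <= 1]].

Definition quasinilpotent S : Prop :=
  opnorm (iter n S) `^ n%:R^-1 @[n --> \oo] --> (0 : R).

Definition quasinilpotent_part S : set Y :=
  [set x | rnorm (iter n S x) `^ n%:R^-1 @[n --> \oo] --> (0 : R)].

(* The sequence is indexed from 1: the value [u 0] is not used. *)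
Definition analytical_core S : set Y :=
  [set x | exists (u : nat -> Y) (delta : R),
     [/\ 0 < delta,
         S (u 1%N) = x,
         forall n, (0 < n)%N -> S (u n.+1) = u n &
         forall n, (0 < n)%N -> rnorm (u n) <= delta ^+ n * rnorm x]].

Definition semi_regular S : Prop :=
  closed (range S) /\ forall n, [set x | iter n S x = 0] `<=` range S.

Definition analytic_on (U : set R[i]) (f : R[i] -> Y) : Prop :=
  forall z0, U z0 -> exists a : nat -> Y,
    \forall z \near z0,
      series (fun n => (z - z0) ^+ n *: a n) n @[n --> \oo] --> f z.

(* [f] is a function on U; its values outside U are irrelevant. *)
Definition SVEP_at S (l0 : R[i]) : Prop :=
  forall U : set R[i], open U -> connected U -> U l0 ->
  forall f : R[i] -> Y, analytic_on U f ->
    (forall l, U l -> l *: f l - S (f l) = 0) ->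
    forall l, U l -> f l = 0.

End Operators.

Section Decompositions.
Context {R : realType} {X : normedModType R[i]}.
Implicit Types (T : X -> X) (M N : submodClosed X).

Definition left_gDrazin_invertible T : Prop :=
  closed (quasinilpotent_part T) /\
  exists M : submodClosed X,
    [/\ closed_subspace M,
        direct_sum [set x | x \in M] (quasinilpotent_part T),
        invariant_subspace T M &
        closed (T @` [set x | x \in M])].

Definition GKD T M N : Prop :=
  [/\ closed_subspace M /\ closed_subspace N,
      direct_sum [set x | x \in M] [set x | x \in N],
      invariant_subspace T M /\ invariant_subspace T N,
      semi_regular (restr_op T M) &
      quasinilpotent (restr_op T N)].

End Decompositions.

(* Main.v *)
Require Import Defs.
From HB Require Import structures.
From mathcomp Require Import all_boot all_order all_algebra.
From mathcomp Require Import all_classical all_reals all_analysis.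
From mathcomp Require Import ring lra.

Set Implicit Arguments.
Unset Strict Implicit.
Unset Printing Implicit Defensive.

Import Order.TTheory GRing.Theory Num.Theory.

Local Open Scope classical_set_scope.
Local Open Scope ring_scope.

(** Write [H0] and [K] for the quasinilpotent part and the analytical core of
[T].  For a generalized Kato decomposition [(M, N)], all the assertions amount
to the injectivity of [T_M].

Suppose that [T_M] is injective.  Its range is closed, so it is bounded below,
[c |a| <= |T a|] on [M], and then [c ^ n |a| <= |T^n a|] keeps every nonzero
vector of [M] out of [H0].  As [T_N] is quasinilpotent, [N] lies in [H0];
hence [H0 = N], which is closed ([GKD_quasinilpotent_part_eq]).  If [x] is in
both [K] and [N], it is [T^n u_n] with [u_n] in [N] of geometric growth, while
[T^n] on [N] is smaller than every geometric sequence, so [x = 0]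
([GKD_core_disjoint]).  If [T f(l) = l f(l)] with [f] analytic, then for small
[l <> 0] the component of [f(l)] in [M] vanishes since [T_M] is bounded below,
and the component in [N] vanishes since it is an eigenvector in [H0]; so [f]
vanishes near [0], and everywhere by the identity theorem
([GKD_injective_SVEP]).

Suppose that [T_M] is not injective.  Semi-regularity places the kernels of
all the powers of [T_M] in its range, and the open mapping theorem bounds
preimages, so a nonzero [u_0] in the kernel starts a backward orbit
[T u_(n+1) = u_n] of geometric growth ([backward_orbit]).  Then
[f(l) = sum_n l ^ n u_n] is analytic near [0], satisfies [T f(l) = l f(l)],
and [f(0) = u_0] is nonzero: the SVEP fails ([semi_regular_SVEP_injective]).
The partial sums of [f(l)] belong to both [K] and [H0], whereas for [l <> 0]
a nonzero [f(l)] is an eigenvector outside [H0]: neither [H0] nor its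
intersection with [K] is closed ([backward_orbit_eq0]).

Finally, if [T] is left generalized Drazin invertible with complement [M],
then [T_M] has closed range and trivial kernel, since kernel vectors lie in
[H0]; and [T] restricted to the Banach space [H0] is quasinilpotent by uniform
boundedness ([locally_quasinilpotent]).  So [(M, H0)] is a generalized Kato
decomposition.  Conversely [H0 = N] exhibits [M] as the required complement. *)

(** * Restriction of scalars to the reals *)

Section RealNorm.
Local Open Scope complex_scope.
Context {R : realType} {Y : normedModType R[i]}.
Implicit Types (x y : Y) (l : R[i]).

Lemma ge0_ReK (z : R[i]) : 0 <= z -> (complex.Re z)%:C = z.
Proof. by case: z => a b; rewrite lecE /= => /andP[/eqP -> _]. Qed.

Lemma real_complexM (a b : R) : (a * b)%:C = a%:C * b%:C :> R[i].
Proof. exact: rmorphM. Qed.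

Lemma normE x : `|x| = (rnorm x)%:C.
Proof. exact/esym/ge0_ReK. Qed.

Lemma rnorm_ge0 x : 0 <= rnorm x.
Proof. by rewrite -ler0c -normE. Qed.

Lemma rnormD x y : rnorm (x + y) <= rnorm x + rnorm y.
Proof. by rewrite -lecR rmorphD /= -!normE ler_normD. Qed.

Lemma rnormZ l x : rnorm (l *: x) = rnorm l * rnorm x.
Proof.
apply: complexI; rewrite real_complexM -[LHS]normE normrZ.
by congr (_ * _); exact: normE.
Qed.

Lemma rnorm_real (a : R) : rnorm (a%:C : R[i]) = `|a|.
Proof.
rewrite /rnorm; transitivity (complex.Re (Num.norm (a%:C : R[i]))) => //.
by rewrite normc_def /= expr0n addr0 sqrtr_sqr.
Qed.

Lemma rnorm0_eq0 x : rnorm x = 0 -> x = 0.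
Proof. by move=> x0; apply/normr0_eq0; rewrite normE x0. Qed.

End RealNorm.

(** The uniform structure is copied and the new norm is convertible to [rnorm],
so limits, open sets and completeness are the same in both spaces by
conversion, and theorems on real Banach spaces apply to [Y] as they stand. *)
Definition realified {R : realType} (Y : normedModType R[i]) : Type := Y.

Section Realified.
Local Open Scope complex_scope.
Context {R : realType} (Y : normedModType R[i]).
Local Notation Yr := (realified Y).

HB.instance Definition _ := PointedUniform.copy Yr Y.
HB.instance Definition _ := GRing.Zmodule.copy Yr Y.

Let realscale (a : R) (y : Yr) : Yr := a%:C *: (y : Y).

Let realscaleA a b y : realscale a (realscale b y) = realscale (a * b) y.
Proof. by rewrite /realscale scalerA rmorphM. Qed.

Let realscale1 : left_id 1 realscale.
Proof. by move=> y; rewrite /realscale scale1r. Qed.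

Let realscaleDr : right_distributive realscale +%R.
Proof. by move=> a x y; rewrite /realscale scalerDr. Qed.

Let realscaleDl y : {morph realscale^~ y : a b / a + b}.
Proof. by move=> a b; rewrite /realscale rmorphD /= scalerDl. Qed.

HB.instance Definition _ := GRing.Zmodule_isLmodule.Build R Yr
  realscaleA realscale1 realscaleDr realscaleDl.

Let rnormMn (y : Yr) n : rnorm (y *+ n : Y) = rnorm (y : Y) *+ n.
Proof. by apply: complexI; rewrite -normE normrMn normE rmorphMn. Qed.

Let rnormN (y : Yr) : rnorm (- y : Y) = rnorm (y : Y).
Proof. by rewrite /rnorm normrN. Qed.

HB.instance Definition _ := Num.Zmodule_isNormed.Build R Yr
  (fun x y => @rnormD R Y x y) (fun x => @rnorm0_eq0 R Y x) rnormMn rnormN.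

Let rball (x : Yr) (e : R) (y : Yr) : Prop := ball (x : Y) e%:C y.

Let rball_center x (e : R) : 0 < e -> rball x e x.
Proof. by move=> e0; apply: ballxx; rewrite ltcR. Qed.

Let rball_sym x y (e : R) : rball x e y -> rball y e x.
Proof. exact: ball_sym. Qed.

Let rball_triangle x y z (e1 e2 : R) :
  rball x e1 y -> rball y e2 z -> rball x (e1 + e2) z.
Proof. by rewrite /rball rmorphD; exact: ball_triangle. Qed.

Let rball_entourage : entourage = entourage_ rball.
Proof.
transitivity (entourage_ (@ball _ Y)); first exact: entourageE_subproof.
apply/seteqP; split => A [e e0 eA].
  exists (complex.Re e); first by move: e0; rewrite /= ltcE => /andP[].
  move=> [x y] xy; apply: eA; move: xy; by rewrite /rball /= ge0_ReK // ltW.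
exists e%:C; first by rewrite /= ltcR.
by move=> [x y] xy; apply: eA.
Qed.

HB.instance Definition _ := Uniform_isPseudoMetric.Build R Yr
  rball_center rball_sym rball_triangle rball_entourage.

Let rball_norm : ball = ball_ (fun x : Yr => `|x|).
Proof.
apply/funext => x; apply/funext => e; apply/funext => y; apply/propext.
rewrite /ball /= /rball -ball_normE /ball_ /= normE ltcR; exact: iff_refl.
Qed.

HB.instance Definition _ := NormedZmod_PseudoMetric_eq.Build R Yr rball_norm.

Let realnormZ (a : R) (y : Yr) : `|a *: y| = `|a| * `|y|.
Proof.
by rewrite {1 3}/Num.norm /= rnormZ rnorm_real.
Qed.

HB.instance Definition _ :=
  PseudoMetricNormedZmod_Lmodule_isNormedModule.Build R Yr realnormZ.

End Realified.

HB.instance Definition _ (R : realType) (Y : completeNormedModType R[i]) :=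
  Complete.copy (realified Y) Y.

(** * Norms, limits and bounded operators *)

Section NormToolbox.
Context {R : realType} {Y : normedModType R[i]}.
Implicit Types (x y : Y) (z w : R[i]) (A : set Y).

Lemma rnorm0 : rnorm (0 : Y) = 0.
Proof. exact: (@normr0 R (realified Y)). Qed.

Lemma rnormN x : rnorm (- x) = rnorm x.
Proof. by rewrite /rnorm normrN. Qed.

Lemma rnormB x y : rnorm (x - y) <= rnorm x + rnorm y.
Proof. exact: (@ler_normB R (realified Y)). Qed.

Lemma rnorm_distC x y : rnorm (x - y) = rnorm (y - x).
Proof. by rewrite -rnormN opprB. Qed.

Lemma rnorm_gt0 x : (0 < rnorm x) = (x != 0).
Proof. exact: (@normr_gt0 R (realified Y)). Qed.

Lemma rnorm_sum (u : nat -> Y) m n :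
  rnorm (\sum_(m <= k < n) u k) <= \sum_(m <= k < n) rnorm (u k).
Proof. exact: (@ler_norm_sum R (realified Y)). Qed.

Lemma rnormM z w : rnorm (z * w) = rnorm z * rnorm w.
Proof. exact: (@rnormZ R R[i]). Qed.

Lemma rnormXn z n : rnorm (z ^+ n) = rnorm z ^+ n.
Proof.
elim: n => [|n IHn]; last by rewrite !exprS rnormM IHn.
by rewrite !expr0 -(normr1 R) -rnorm_real.
Qed.

Lemma rcvgP {I} {F : set_system I} {FF : Filter F} (f : I -> Y) l :
  f @ F --> l <-> forall e : R, 0 < e -> \forall t \near F, rnorm (l - f t) <= e.
Proof. exact: (@cvgrPdist_le R (realified Y)). Qed.

Lemma rcvg_seqP (u : nat -> Y) l : u @ \oo --> l <->
  forall e : R, 0 < e -> exists n0, forall n, (n0 <= n)%N -> rnorm (l - u n) <= e.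
Proof.
split=> [/rcvgP H e /H [n0 _ Hn]|H]; first by exists n0.
by apply/rcvgP => e /H [n0 Hn]; exists n0.
Qed.

Lemma rnbhsP x A :
  nbhs x A <-> exists2 e : R, 0 < e & forall y, rnorm (x - y) < e -> A y.
Proof. exact: (@nbhs_normP R (realified Y)). Qed.

Lemma rclosedP A : closed A <->
  forall x, (forall e : R, 0 < e -> exists2 y, A y & rnorm (x - y) < e) -> A x.
Proof.
split=> [cA x Hx|H x clx].
  apply: cA => B /rnbhsP[e e0 eB].
  by have [y Ay xy] := Hx e e0; exists y; split => //; exact: eB.
apply: H => e e0; have [|y [Ay xy]] := clx [set y | rnorm (x - y) < e].
  by apply/rnbhsP; exists e.
by exists y.
Qed.

Lemma closed_seq A (u : nat -> Y) l :
  closed A -> (forall n, A (u n)) -> u @ \oo --> l -> A l.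
Proof. by move=> cA Au ul; apply: (closed_cvg _ cA _ _ ul); exact: nearW. Qed.

End NormToolbox.

Section BoundedOperators.
Context {R : realType} {Y Z : normedModType R[i]}.
Local Open Scope complex_scope.

Lemma continuous_bounded (S : {linear Y -> Z}) : continuous S ->
  exists2 C : R, 0 < C & forall x, rnorm (S x) <= C * rnorm x.
Proof.
move=> /linear_bounded_continuous/linear_boundedP/pinfty_ex_gt0[c c0 Hc].
have cE : c = (complex.Re c)%:C by rewrite ge0_ReK // ltW.
exists (complex.Re c); first by rewrite -ltcR -cE.
by move=> x; rewrite -lecR real_complexM -cE -[X in X <= _]normE -[X in _ * X]normE.
Qed.

Lemma bounded_continuous (S : {linear Y -> Z}) (C : R) :
  (forall x, rnorm (S x) <= C * rnorm x) -> continuous S.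
Proof.
move=> SC x; apply/rcvgP => e e0.
have C0 : 0 < `|C| + 1 by apply: ltr_wpDl.
apply/rnbhsP; exists (e / (`|C| + 1)); first exact: divr_gt0.
move=> y xy; rewrite -linearB; apply: (le_trans (SC _)).
apply: (@le_trans _ _ ((`|C| + 1) * rnorm (x - y))).
  by rewrite ler_wpM2r ?rnorm_ge0 // (le_trans (ler_norm _)) // lerDl.
by rewrite -ler_pdivlMl // mulrC ltW.
Qed.

End BoundedOperators.

(** * Closed subspaces and restricted operators *)

Section SubspaceOf.
Context {R : realType} {Y : normedModType R[i]}.
Variables (A : set Y) (A0 : A 0).
Variable AZD : forall (a : R[i]) x y, A x -> A y -> A (a *: x + y).

Let A_pred : {pred Y} := fun x => x \in A.

Let A_submod : GRing.subsemimod_closed A_pred.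
Proof.
have AD x y : A x -> A y -> A (x + y) by move=> /(AZD 1) /[apply]; rewrite scale1r.
have AZ a x : A x -> A (a *: x) by move=> /(AZD a) /(_ A0); rewrite addr0.
split; first split; rewrite /A_pred.
- by rewrite /in_mem /= inE.
- by move=> x y; rewrite /in_mem /= !inE; exact: AD.
- by move=> a x; rewrite /in_mem /= !inE; exact: AZ.
Qed.

Definition subspace_of : submodClosed Y :=
  HB.pack A_pred (GRing.isSubmodClosed.Build R[i] Y A_pred A_submod).

Lemma mem_subspace_of : [set x | x \in subspace_of] = A.
Proof. by apply/seteqP; split => x /=; rewrite unfold_in /= inE. Qed.

End SubspaceOf.

(** The closedness proof is an index of the type, which makes completeness a
canonical structure: a closed subspace of a Banach space is a Banach space. *)
Definition closed_subspace_type {R : realType} {Y : normedModType R[i]}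
  (M : submodClosed Y) (cM : closed_subspace M) : Type := subspace_type M.

Section ClosedSubspaceComplete.
Context {R : realType} {Y : completeNormedModType R[i]}.
Variables (M : submodClosed Y) (cM : closed_subspace M).
Local Notation sM := (closed_subspace_type cM).

HB.instance Definition _ := NormedModule.copy sM (subspace_type M).

Let subspace_complete (F : set_system sM) :
  ProperFilter F -> cauchy F -> cvg F.
Proof.
move=> FF Fc; pose v (x : sM) : realified Y := val (x : subspace_type M).
have /cauchy_cvgP/cvg_ex[l Fl] : cauchy (v @ F).
  apply/cauchy_ballP => e e0.
  have /cauchy_ballP := (Fc : @cauchy (realified sM) F).
  move=> /(_ e e0) Fe; near_simpl.
  move: Fe; apply: filterS => -[x y] /=.
  by rewrite -!ball_normE.
have lM : [set x | x \in M] l.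
  by apply: (closed_cvg _ cM _ _ Fl); apply: nearW => -[x Mx].
apply/cvg_ex; exists (SubspaceType lM : sM).
apply/(@fcvgrPdist_lt _ (realified sM)) => e e0.
by move/cvgrPdist_lt : Fl => /(_ e e0).
Qed.

HB.instance Definition _ := Uniform_isComplete.Build sM subspace_complete.

End ClosedSubspaceComplete.

Section RestrictedOperator.
Context {R : realType} {X : normedModType R[i]}.
Variables (T : {linear X -> X}) (M : submodClosed X) (MT : invariant_subspace T M).

Lemma val_restr (x : subspace_type M) : val (restr_op T M x) = T (val x).
Proof. by rewrite insubdK //; apply: MT; case: x. Qed.

Lemma val_iter_restr n (x : subspace_type M) :
  val (iter n (restr_op T M) x) = iter n T (val x).
Proof. by elim: n => // n IHn; rewrite !iterS val_restr IHn. Qed.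

Lemma restr_linear : linear (restr_op T M).
Proof.
move=> a x y; apply: val_inj.
by rewrite val_restr linearP [RHS]linearP /= !val_restr.
Qed.

Definition restr_lin : {linear subspace_type M -> subspace_type M} :=
  HB.pack (restr_op T M)
    (GRing.isLinear.Build R[i] (subspace_type M) (subspace_type M) _
      (restr_op T M) restr_linear).

Lemma restr_continuous : continuous T -> continuous (restr_op T M).
Proof.
move=> /continuous_bounded[C C0 TC].
apply: (@bounded_continuous _ _ _ restr_lin C) => x.
by have := TC (val x); rewrite -val_restr.
Qed.

End RestrictedOperator.

(** * Geometric estimates, Baire and open mapping *)

Section GeometricSeries.
Context {R : realType}.
Implicit Types (q a e : R).

Lemma half_ge0_lt1 : 0 <= (2^-1 : R) < 1.
Proof. by rewrite invr_ge0 ler0n /= invf_lt1 ?ltr1n. Qed.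

Lemma geometric_small a q e : 0 <= q < 1 -> 0 < e ->
  exists n0, forall n, (n0 <= n)%N -> a * q ^+ n <= e.
Proof.
move=> /andP[q0 q1] e0.
have nq : `|q| < 1 by rewrite ger0_norm.
have /cvgrPdist_le/(_ e e0)[n0 _ H] := @cvg_geometric R a q nq.
by exists n0 => n /H /=; rewrite sub0r normrN; apply: le_trans; exact: ler_norm.
Qed.

Lemma geometric_sum_le a q m n : 0 <= a -> 0 <= q < 1 ->
  \sum_(m <= k < n) a * q ^+ k <= a * q ^+ m / (1 - q).
Proof.
move=> a0 /andP[q0 q1]; have q10 : 0 < 1 - q by rewrite subr_gt0.
have am k : 0 <= a * q ^+ k by rewrite mulr_ge0 ?exprn_ge0.
rewrite ler_pdivlMr //; have [mn|nm] := leqP m n; last first.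
  by rewrite big_geq ?mul0r // ltnW.
apply: (@le_trans _ _ (a * q ^+ m - a * q ^+ n)); last by rewrite lerBlDr lerDl.
rewrite mulr_suml le_eqVlt; apply/orP; left; apply/eqP.
transitivity (\sum_(m <= k < n) (- (a * q ^+ k.+1) - - (a * q ^+ k))).
  by apply: eq_bigr => k _; rewrite exprS; ring.
by rewrite telescope_sumr // opprK addrC.
Qed.

Context {Y : normedModType R[i]}.
Implicit Types (u : nat -> Y).

Lemma rnorm_lim_le u l b :
  (forall n, rnorm (u n) <= b) -> u @ \oo --> l -> rnorm l <= b.
Proof.
move=> ub /rcvg_seqP ul; apply/ler_addgt0Pr => e e0; have [n0 H] := ul e e0.
rewrite -(subrK (u n0) l) [leRHS]addrC.
by apply: (le_trans (rnormD _ _)); apply: lerD => //; exact: H.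
Qed.

Lemma series_geometric_le u a q m n : 0 <= a -> 0 <= q < 1 ->
  (forall k, rnorm (u k) <= a * q ^+ k) ->
  rnorm (\sum_(m <= k < n) u k) <= a * q ^+ m / (1 - q).
Proof.
move=> a0 q01 ua; apply: (le_trans (rnorm_sum _ _ _)).
by apply: le_trans (geometric_sum_le m n a0 q01); apply: ler_sum.
Qed.

End GeometricSeries.

Section CompleteSpace.
Context {R : realType} {Y : completeNormedModType R[i]}.

Lemma geometric_series_cvg (u : nat -> Y) (a q : R) : 0 <= q < 1 ->
  (forall k, rnorm (u k) <= a * q ^+ k) -> cvgn (series u).
Proof.
move=> /andP[q0 q1] ua; apply: (@normed_cvg R (realified Y)).
apply: (series_le_cvg (v_ := geometric a q)) => [n|n|n|].
- exact: normr_ge0.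
- by apply: le_trans (ua n); exact: rnorm_ge0.
- exact: ua.
- by apply: is_cvg_geometric_series; rewrite ger0_norm.
Qed.

(** Otherwise the complements of the closures of the [A n] would be dense open
sets with empty intersection, against the Baire theorem. *)
Lemma baire_cover (A : nat -> set Y) : (forall y, exists n, A n y) ->
  exists n (x : Y) (r : R), 0 < r /\ forall y, rnorm (x - y) < r ->
    forall e : R, 0 < e -> exists2 a, A n a & rnorm (y - a) < e.
Proof.
move=> Acover; apply: contrapT => noball.
have /(@Baire R (realified Y)) : forall n,
    open (~` closure (A n)) /\ dense (~` closure (A n) : set (realified Y)).
  move=> n; split; first by apply: closed_openC; exact: closed_closure.
  apply: contrapT => /denseNE[B [[x Bx]]].
  rewrite -subsets_disjoint => BA.
  have /rnbhsP[r r0 xr] : nbhs (x : Y) B by exact: open_nbhs_nbhs.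
  apply: noball; exists n, x, r; split => // y /xr /BA yA e e0.
  have [|a [Aa ya]] := yA [set a : Y | rnorm (y - a) < e].
    by apply/rnbhsP; exists e.
  by exists a.
move=> /(_ setT)[||y [_ yA]]; first by exists point.
  exact: openT.
have [n Any] := Acover y.
by apply: (yA n) => //; exact: subset_closure.
Qed.

End CompleteSpace.

Section OpenMapping.
Context {R : realType} {Y Z : completeNormedModType R[i]}.
Local Open Scope complex_scope.

(** The images of the balls of integral radius cover [Z], so one of them is
dense in some ball of [Z].  A small vector is a difference of two points of
that ball, hence is approximated by the image of a difference of two bounded
vectors; scaling gives the estimate for all vectors. *)
Let approx_preimage (S : {linear Y -> Z}) : (forall z, exists y, S y = z) ->
  exists2 c : R, 0 < c & forall z, exists2 y,
    rnorm y <= c * rnorm z & rnorm (z - S y) <= 2^-1 * rnorm z.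
Proof.
move=> Ssurj; pose A n := S @` [set y | rnorm y <= n%:R].
have [|n [x [r [r0 H]]]] := baire_cover (A := A).
  move=> z; have [y Sy] := Ssurj z; exists (Num.truncn (rnorm y)).+1; exists y => //=.
  exact/ltW/truncnS_gt.
exists (4 * n.+1%:R / r); first by rewrite divr_gt0 ?mulr_gt0.
move=> z; have [->|z0] := eqVneq z 0.
  by exists 0; rewrite ?linear0 ?addr0 !rnorm0 mulr0.
have nz : 0 < rnorm z by rewrite rnorm_gt0.
pose t : R := r / (2 * rnorm z).
have t0 : 0 < t by rewrite divr_gt0 ?mulr_gt0.
have tz : rnorm (t%:C *: z) = r / 2.
  rewrite rnormZ rnorm_real gtr0_norm // /t; field.
  exact: lt0r_neq0.
(* Two errors of r / 8 scale by 1 / t to half of the norm of z. *)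
have e0 : 0 < r / 8 by rewrite divr_gt0.
have [|_ [y1 /= y1n <-] H1] := H x _ (r / 8) e0; first by rewrite subrr rnorm0.
have [|_ [y2 /= y2n <-] H2] := H (x - t%:C *: z) _ (r / 8) e0.
  by rewrite opprB addrC subrK tz ltr_pdivrMr // ltr_pMr // ltr1n.
have tK (v : Z) : v = t^-1%:C *: (t%:C *: v).
  by rewrite scalerA -real_complexM mulVf ?scale1r // lt0r_neq0.
exists (t^-1%:C *: (y1 - y2)).
  rewrite rnormZ rnorm_real gtr0_norm ?invr_gt0 //.
  apply: (@le_trans _ _ (t^-1 * (n%:R + n%:R))).
    rewrite ler_pM2l ?invr_gt0 //; apply: (le_trans (rnormB _ _)); exact: lerD.
  have -> : 4 * n.+1%:R / r * rnorm z = t^-1 * (n.+1%:R + n.+1%:R).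
    by rewrite /t; field; rewrite !lt0r_neq0.
  by rewrite ler_pM2l ?invr_gt0 // lerD // ler_nat.
rewrite {1}(tK z) [S (_ *: _)]linearZ -scalerBr rnormZ rnorm_real gtr0_norm ?invr_gt0 //.
rewrite linearB /=.
have -> : t%:C *: z - (S y1 - S y2) = (x - S y1) - (x - t%:C *: z - S y2).
  rewrite -[x - t%:C *: z - _]addrA [X in _ = _ + X]opprD [RHS]addrACA subrr.
  by rewrite add0r !opprB opprK [LHS]addrCA [LHS]addrC -addrA [LHS]addrC addrA.
apply: (@le_trans _ _ (t^-1 * (r / 8 + r / 8))).
  by rewrite ler_pM2l ?invr_gt0 // (le_trans (rnormB _ _)) // lerD // ltW.
rewrite /t le_eqVlt; apply/orP; left; apply/eqP; field.
by rewrite !lt0r_neq0.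
Qed.

(** Correcting the error of an approximate preimage again and again, each time
halving it, gives a convergent series whose sum is an exact preimage. *)
Theorem open_mapping (S : {linear Y -> Z}) :
  continuous S -> (forall z, exists y, S y = z) ->
  exists2 c : R, 0 < c & forall z, exists2 y, S y = z & rnorm y <= c * rnorm z.
Proof.
move=> Scont Ssurj; have [c c0 Happ] := approx_preimage Ssurj.
have /choice[s Hs] : forall z, exists y,
    rnorm y <= c * rnorm z /\ rnorm (z - S y) <= 2^-1 * rnorm z.
  by move=> z; have [y yz zy] := Happ z; exists y.
exists (c * 2) => [|z]; first exact: mulr_gt0.
pose w n := iter n (fun v => v - S (s v)) z.
pose u n := s (w n).
have wn n : rnorm (w n) <= rnorm z * 2^-1 ^+ n.
  elim: n => [|n IHn]; first by rewrite expr0 mulr1.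
  apply: (le_trans (Hs (w n)).2); rewrite exprS mulrCA ler_pM2l //.
have un n : rnorm (u n) <= (c * rnorm z) * 2^-1 ^+ n.
  by rewrite -mulrA (le_trans (Hs (w n)).1) // ler_pM2l.
have half := @half_ge0_lt1 R.
have ucvg := geometric_series_cvg half un.
have Su n : S (series u n) = z - w n.
  elim: n => [|n IHn]; first by rewrite seriesEnat /= big_geq // linear0 subrr.
  by rewrite seriesSr linearD IHn /= -/(u n) opprB addrA addrAC.
have w0 : w @ \oo --> 0.
  apply/rcvg_seqP => e e0; have [n0 H] := geometric_small (rnorm z) half e0.
  by exists n0 => n /H; apply: le_trans; rewrite sub0r rnormN.
exists (limn (series u)).
  have Sl : S \o series u @ \oo --> S (limn (series u)).
    by apply: continuous_cvg; [exact: Scont|exact: ucvg].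
  have zl : S \o series u @ \oo --> z.
    rewrite (_ : _ \o _ = (fun n => z - w n)); last exact/funext.
    by rewrite -[z in X in _ --> X]subr0; apply: cvgB => //; exact: cvg_cst.
  exact: (cvg_unique (@norm_hausdorff _ Z) Sl zl).
apply: (rnorm_lim_le _ ucvg) => n.
apply: (le_trans (series_geometric_le 0 n _ half un)).
  by rewrite mulr_ge0 ?rnorm_ge0 // ltW.
rewrite expr0 mulr1 mulrAC le_eqVlt; apply/orP; left; apply/eqP.
by field.
Qed.

End OpenMapping.

Section ClosedRange.
Context {R : realType} {Y : completeNormedModType R[i]}.

(** The closed range is itself a Banach space, onto which [S] is open. *)
Lemma closed_range_preimage (S : {linear Y -> Y}) :
  continuous S -> closed (range S) ->
  exists2 c : R, 0 < c &
    forall y, range S y -> exists2 x, S x = y & rnorm x <= c * rnorm y.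
Proof.
move=> Sc Scl.
have r0 : range S 0 by exists 0; rewrite ?linear0.
have rZD (a : R[i]) x y : range S x -> range S y -> range S (a *: x + y).
  by move=> [x' _ <-] [y' _ <-]; exists (a *: x' + y'); rewrite ?linearP.
pose F := subspace_of r0 rZD.
have FE : [set x | x \in F] = range S := mem_subspace_of r0 rZD.
have cF : closed_subspace F by rewrite /closed_subspace FE.
have SF x : S x \in F.
  have : range S (S x) by exists x.
  by rewrite -FE.
pose S' (x : Y) : closed_subspace_type cF := SubspaceType (SF x).
have S'lin : linear S'.
  by move=> a x y; apply: val_inj; exact: (linearP S a x y).
pose SL : {linear Y -> closed_subspace_type cF} :=
  HB.pack S' (GRing.isLinear.Build R[i] Y (closed_subspace_type cF) _ S' S'lin).
have [C C0 SC] := continuous_bounded Sc.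
have [||c c0 Hc] := open_mapping (S := SL).
- exact: (@bounded_continuous _ _ _ SL C).
- move=> [y yF]; have : range S y by rewrite -FE.
  by move=> [x _ Sx]; exists x; apply: val_inj.
exists c => // _ [x _ <-]; have [x' Sx' x'c] := Hc (S' x).
by exists x' => //; move/(congr1 val) : Sx'.
Qed.

End ClosedRange.

(** * Quasinilpotence *)

Section LocalSpectralRadius.
Context {R : realType}.

(** Trades the roots in the definitions of quasinilpotence for domination by
every geometric sequence, the form in which all estimates below are done. *)
Lemma root_cvg0P (a : nat -> R) : (forall n, 0 <= a n) ->
  a n `^ n%:R^-1 @[n --> \oo] --> (0 : R) <->
  forall e : R, 0 < e -> exists n0, forall n, (n0 <= n)%N -> a n <= e ^+ n.
Proof.
move=> a0; have rootP (e : R) n : 0 < e -> (0 < n)%N ->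
    (a n `^ n%:R^-1 <= e) = (a n <= e ^+ n).
  move=> e0 n0; have n0' : n%:R != 0 :> R by rewrite pnatr_eq0 -lt0n.
  apply/idP/idP => H.
    rewrite -[a n]powRr1 // -(mulVf n0') powRrM powR_mulrn ?powR_ge0 //.
    by rewrite lerXn2r // nnegrE ?powR_ge0 // ltW.
  have -> : e = (e ^+ n) `^ n%:R^-1.
    by rewrite -powR_mulrn ?ltW // -powRrM mulfV // powRr1 // ltW.
  by apply: ge0_ler_powR => //; rewrite ?invr_ge0 ?nnegrE ?exprn_ge0 // ltW.
split=> [/cvgrPdist_le H e e0|H].
  have [n0 _ Hn] := H e e0; exists n0.+1 => n n0n.
  rewrite -rootP //; last exact: leq_ltn_trans n0n.
  apply: le_trans (Hn n (ltnW n0n)); rewrite sub0r normrN; exact: ler_norm.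
apply/cvgrPdist_le => e e0; have [n0 Hn] := H e e0.
exists n0.+1 => // n n0n; rewrite sub0r normrN ger0_norm ?powR_ge0 //.
by rewrite rootP ?Hn ?(ltnW n0n) //; exact: leq_ltn_trans n0n.
Qed.

Context {Y : normedModType R[i]}.
Implicit Types (S : {linear Y -> Y}) (x y : Y).

Lemma quasinilpotent_partP (S : Y -> Y) x : quasinilpotent_part S x <->
  forall e : R, 0 < e -> exists n0, forall n, (n0 <= n)%N ->
    rnorm (iter n S x) <= e ^+ n.
Proof. by apply: root_cvg0P => n; exact: rnorm_ge0. Qed.

Lemma bounded_iter (S : Y -> Y) (C : R) n x : 0 <= C ->
  (forall x, rnorm (S x) <= C * rnorm x) ->
  rnorm (iter n S x) <= C ^+ n * rnorm x.
Proof.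
move=> C0 SC; elim: n => [|n IHn]; first by rewrite expr0 mul1r.
by rewrite iterS exprS -mulrA (le_trans (SC _)) // ler_wpM2l.
Qed.

Lemma iter_linear S n (a : R[i]) x y :
  iter n S (a *: x + y) = a *: iter n S x + iter n S y.
Proof. by elim: n => // n IHn; rewrite !iterS IHn linearP. Qed.

Lemma iter_linear0 S n : iter n S 0 = 0.
Proof. by elim: n => // n IHn; rewrite iterS IHn linear0. Qed.

Lemma iter_linearZ S n (a : R[i]) x : iter n S (a *: x) = a *: iter n S x.
Proof. by rewrite -[a *: x]addr0 iter_linear iter_linear0 addr0. Qed.

Lemma rnorm_le_opnorm (S : {linear Y -> Y}) n x : continuous S ->
  rnorm (iter n S x) <= opnorm (iter n S) * rnorm x.
Proof.
move=> /continuous_bounded[C C0 SC].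
have [->|x0] := eqVneq x 0.
  by rewrite iter_linear0 rnorm0 mulr0.
have nx : 0 < rnorm x by rewrite rnorm_gt0.
rewrite -ler_pdivrMr //; apply: ub_le_sup.
  exists (C ^+ n) => _ [y /= y1 <-].
  apply: (le_trans (bounded_iter n y (ltW C0) SC)).
  by rewrite ler_piMr // exprn_ge0 // ltW.
exists ((rnorm x)^-1%:C%C *: x) => /=.
  by rewrite rnormZ rnorm_real gtr0_norm ?invr_gt0 // mulVf // lt0r_neq0.
by rewrite iter_linearZ rnormZ rnorm_real gtr0_norm ?invr_gt0 // mulrC.
Qed.

Lemma quasinilpotentP (S : {linear Y -> Y}) : continuous S ->
  quasinilpotent S <->
  forall e : R, 0 < e -> exists n0, forall n, (n0 <= n)%N ->
    forall x, rnorm (iter n S x) <= e ^+ n * rnorm x.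
Proof.
move=> Sc; have opnorm_ge0 n : 0 <= opnorm (iter n S).
  have [[x x0]|] := pselect (exists x : Y, x != 0).
    have := rnorm_le_opnorm n x Sc.
    rewrite -rnorm_gt0 in x0; rewrite -ler_pdivrMr //; apply: le_trans.
    by rewrite divr_ge0 ?rnorm_ge0.
  move=> Y0; rewrite /opnorm [X in sup X](_ : _ = [set 0]) ?sup1 //.
  have Y0' (x : Y) : x = 0 by apply/eqP/negPn/negP => x0; apply: Y0; exists x.
  apply/seteqP; split => [_ [x _ <-]|_ ->]; first by rewrite (Y0' (iter n S x)) rnorm0.
  by exists 0; rewrite /= ?(Y0' (iter n S 0)) rnorm0.
rewrite /quasinilpotent root_cvg0P //; split=> H e e0; have [n0 Hn] := H e e0;
    exists n0 => n n0n.
  move=> x; apply: (le_trans (rnorm_le_opnorm n x Sc)).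
  by rewrite ler_wpM2r ?rnorm_ge0 // Hn.
apply: ge_sup; first by exists (rnorm (iter n S 0)), 0; rewrite //= rnorm0.
move=> _ [x /= x1 <-]; apply: (le_trans (Hn n n0n x)).
by rewrite ler_piMr // exprn_ge0 // ltW.
Qed.

Lemma quasinilpotent_part0 S : quasinilpotent_part S 0.
Proof.
apply/quasinilpotent_partP => e e0; exists 0%N => n _.
by rewrite iter_linear0 rnorm0 exprn_ge0 // ltW.
Qed.

(** The constant [|a| + 1] is absorbed by working with [e / 2]: the spare factor
[2 ^ - n] eventually compensates it. *)
Lemma quasinilpotent_partZD S (a : R[i]) x y :
  quasinilpotent_part S x -> quasinilpotent_part S y ->
  quasinilpotent_part S (a *: x + y).
Proof.
move=> /quasinilpotent_partP Hx /quasinilpotent_partP Hy.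
apply/quasinilpotent_partP => e e0; have e20 : 0 < e / 2 by rewrite divr_gt0.
have [n1 H1] := Hx _ e20; have [n2 H2] := Hy _ e20.
have half := @half_ge0_lt1 R.
have [n3 H3] := geometric_small (rnorm a + 1) half ltr01.
exists (maxn n1 (maxn n2 n3)) => n; rewrite !geq_max => /and3P[n1n n2n n3n].
rewrite iter_linear (le_trans (rnormD _ _)) // rnormZ.
apply: (@le_trans _ _ ((rnorm a + 1) * (e / 2) ^+ n)).
  by rewrite mulrDl mul1r lerD ?H2 // ler_wpM2l ?rnorm_ge0 // H1.
by rewrite exprMn mulrCA ler_piMr ?H3 // exprn_ge0 // ltW.
Qed.

(** Orbits of [H0] decay faster than [(c / 2) ^ n], too fast for a nonzero
[x] whose orbit is at least [c ^ n |x|]. *)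
Lemma quasinilpotent_part_eq0 (S : Y -> Y) x (c : R) : 0 < c ->
  (forall n, c ^+ n * rnorm x <= rnorm (iter n S x)) ->
  quasinilpotent_part S x -> x = 0.
Proof.
move=> c0 Hc /quasinilpotent_partP /(_ (c / 2)) [|n0 Hn]; first exact: divr_gt0.
apply: rnorm0_eq0; apply/eqP; rewrite eq_le rnorm_ge0 andbT.
apply/ler_addgt0Pr => e e0; rewrite add0r.
have half := @half_ge0_lt1 R.
have [n1 H1] := geometric_small 1 half e0.
pose n := maxn n0 n1; have cn : 0 < c ^+ n by rewrite exprn_gt0.
rewrite -(ler_pM2l cn); apply: (le_trans (Hc n)).
apply: (le_trans (Hn n (leq_maxl _ _))); rewrite exprMn ler_pM2l //.
by have := H1 n (leq_maxr _ _); rewrite mul1r.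
Qed.

Lemma quasinilpotent_part_eigen S x (l : R[i]) : l != 0 -> S x = l *: x ->
  quasinilpotent_part S x -> x = 0.
Proof.
move=> l0 Sx; apply: (@quasinilpotent_part_eq0 _ _ (rnorm l)); first by rewrite rnorm_gt0.
move=> n; suff -> : iter n S x = l ^+ n *: x by rewrite rnormZ rnormXn.
elim: n => [|n IHn]; first by rewrite expr0 scale1r.
by rewrite iterS IHn linearZ /= Sx scalerA exprSr.
Qed.

Lemma quasinilpotent_part_image S x :
  quasinilpotent_part S (S x) -> quasinilpotent_part S x.
Proof.
move=> /quasinilpotent_partP Hx; apply/quasinilpotent_partP => e e0.
have e20 : 0 < e / 2 by rewrite divr_gt0.
have [n1 H1] := Hx _ e20.
have half := @half_ge0_lt1 R.
have [n2 H2] := geometric_small 1 half e0.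
exists (maxn n1 n2).+1 => -[//|n]; rewrite ltnS geq_max => /andP[n1n n2n].
rewrite iterSr (le_trans (H1 n n1n)) // exprMn [leRHS]exprSr.
have := H2 n n2n; rewrite mul1r; apply: ler_wpM2l.
by rewrite exprn_ge0 // ltW.
Qed.

End LocalSpectralRadius.

Section UniformBoundedness.
Context {R : realType} {Y : completeNormedModType R[i]}.

(** A uniform boundedness argument: by Baire, the bound [(e / 2) ^ m] holds on
a whole ball for all large [m]; differences and scaling extend it to the unit
ball with a constant, which the spare factor [2 ^ - m] absorbs. *)
Lemma locally_quasinilpotent (S : {linear Y -> Y}) : continuous S ->
  (forall x, quasinilpotent_part S x) -> quasinilpotent S.
Proof.
move=> Sc H; apply/quasinilpotentP => // e e0.
have [C C0 SC] := continuous_bounded Sc.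
have e20 : 0 < e / 2 by rewrite divr_gt0.
(* The sets A n are closed, since the iterates are continuous; this is what
   ballA uses to pass from dense in a ball to containing it. *)
pose A n := [set x : Y | forall m, (n <= m)%N -> rnorm (iter m S x) <= (e / 2) ^+ m].
have [|n [x [r [r0 Hr]]]] := baire_cover (A := A).
  by move=> x; have /quasinilpotent_partP/(_ _ e20)[n Hn] := H x; exists n.
have ballA y m : rnorm (x - y) < r -> (n <= m)%N ->
    rnorm (iter m S y) <= (e / 2) ^+ m.
  move=> xy nm; apply/ler_addgt0Pr => d d0.
  have [|a Aa ya] := Hr y xy (d / C ^+ m); first by rewrite divr_gt0 ?exprn_gt0.
  have -> : y = 1 *: (y - a) + a by rewrite scale1r subrK.
  rewrite iter_linear scale1r addrC (le_trans (rnormD _ _)) // lerD ?Aa //.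
  rewrite (le_trans (bounded_iter m _ (ltW C0) SC)) // -ler_pdivlMl ?exprn_gt0 //.
  by rewrite mulrC ltW.
have half := @half_ge0_lt1 R.
have [n1 H1] := geometric_small (4 / r) half ltr01.
exists (maxn n n1) => m; rewrite geq_max => /andP[nm n1m] y.
have [->|y0] := eqVneq y 0.
  by rewrite iter_linear0 rnorm0 mulr0.
have ny : 0 < rnorm y by rewrite rnorm_gt0.
pose t : R := r / (2 * rnorm y).
have t0 : 0 < t by rewrite divr_gt0 ?mulr_gt0.
have ty : rnorm (t%:C%C *: y) = r / 2.
  rewrite rnormZ rnorm_real gtr0_norm // /t; field.
  exact: lt0r_neq0.
have r2 : r / 2 < r by rewrite ltr_pdivrMr // ltr_pMr // ltr1n.
have Hty : rnorm (iter m S (t%:C%C *: y)) <= 2 * (e / 2) ^+ m.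
  have -> : t%:C%C *: y = (-1) *: x + (x + t%:C%C *: y).
    by rewrite scaleN1r addKr.
  rewrite iter_linear scaleN1r (le_trans (rnormD _ _)) // rnormN mulr2n mulrDl !mul1r.
  rewrite lerD // ballA ?subrr ?rnorm0 //.
  by rewrite opprD addNKr rnormN ty.
move: Hty; rewrite iter_linearZ rnormZ rnorm_real gtr0_norm // -ler_pdivlMl //.
move=> /le_trans; apply.
have -> : t^-1 * (2 * (e / 2) ^+ m) = e ^+ m * rnorm y * (4 / r * 2^-1 ^+ m).
  rewrite exprMn /t; field.
  by rewrite !lt0r_neq0.
by rewrite ler_piMr ?H1 // mulr_ge0 ?exprn_ge0 ?rnorm_ge0 // ltW.
Qed.

End UniformBoundedness.

(** * Analyticity of power series *)

Section PowerSeries.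
Context {R : realType} {Y : completeNormedModType R[i]}.
Implicit Types (w : nat -> Y) (z : R[i]) (A C : R).

Definition power_sum w z : Y := limn (series (fun k => z ^+ k *: w k)).

(** With [B] the backward shift on sequences, this is [(1 - z B)^-1 w]; its entry
at [0] is the sum of the power series. *)
Definition tail_sums w z : nat -> Y := fun n => power_sum (fun k => w (n + k)%N) z.

Definition geometric_growth C w :=
  exists2 A : R, 0 <= A & forall n, rnorm (w n) <= A * C ^+ n.

Section Radius.
Variables (C : R) (z : R[i]) (C0 : 0 <= C) (zC : rnorm z * C < 1).

Let q01 : 0 <= rnorm z * C < 1.
Proof. by rewrite mulr_ge0 ?rnorm_ge0. Qed.

Let term_le w A : (forall n, rnorm (w n) <= A * C ^+ n) ->
  forall k, rnorm (z ^+ k *: w k) <= A * (rnorm z * C) ^+ k.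
Proof.
move=> wA k; rewrite rnormZ rnormXn exprMn mulrCA.
by rewrite ler_wpM2l ?exprn_ge0 ?rnorm_ge0.
Qed.

Let tail_le w A : (forall n, rnorm (w n) <= A * C ^+ n) ->
  forall n k, rnorm (w (n + k)%N) <= A * C ^+ n * C ^+ k.
Proof. by move=> wA n k; rewrite -mulrA -exprD. Qed.

Lemma power_sum_cvg w : geometric_growth C w ->
  series (fun k => z ^+ k *: w k) @ \oo --> power_sum w z.
Proof. by move=> [A A0 /term_le]; exact: geometric_series_cvg. Qed.

Lemma power_sum_le w A : 0 <= A -> (forall n, rnorm (w n) <= A * C ^+ n) ->
  rnorm (power_sum w z) <= A / (1 - rnorm z * C).
Proof.
move=> A0 wA; have wC : geometric_growth C w by exists A.
apply: rnorm_lim_le (power_sum_cvg wC) => n.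
by have := series_geometric_le 0 n A0 q01 (term_le wA); rewrite expr0 mulr1.
Qed.

Lemma tail_sums_le w A : 0 <= A -> (forall n, rnorm (w n) <= A * C ^+ n) ->
  forall n, rnorm (tail_sums w z n) <= A / (1 - rnorm z * C) * C ^+ n.
Proof.
move=> A0 wA n; rewrite mulrAC; apply: power_sum_le; first by rewrite mulr_ge0 ?exprn_ge0.
exact: tail_le.
Qed.

Lemma tail_sumsS w : geometric_growth C w ->
  forall n, tail_sums w z n = w n + z *: tail_sums w z n.+1.
Proof.
move=> [A A0 wA] n; pose v m k := w (m + k)%N.
have vC m : geometric_growth C (v m).
  by exists (A * C ^+ m); [rewrite mulr_ge0 ?exprn_ge0|exact: tail_le].
have := power_sum_cvg (vC n); rewrite -cvg_shiftS.
have -> : [sequence series (fun k => z ^+ k *: v n k) m.+1]_m =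
    (fun m => w n + z *: series (fun k => z ^+ k *: v n.+1 k) m).
  apply/funext => m /=; rewrite !seriesEord /= big_ord_recl /v addn0 expr0 scale1r.
  congr (_ + _); rewrite scaler_sumr; apply: eq_bigr => i _.
  by rewrite scalerA -exprS addnS.
move=> H; apply: (cvg_unique (@norm_hausdorff _ Y) H).
by apply: cvgD; [exact: cvg_cst|apply: cvgZl_tmp; exact: power_sum_cvg].
Qed.

(** Iterating gives [w n = z ^ m w (n + m)], which is at most a constant times
[(|z| C) ^ m].  This is the injectivity of [1 - z B] on sequences of growth
[C], by which two sums of power series are shown equal. *)
Lemma backward_fixed_eq0 w : geometric_growth C w ->
  (forall n, w n = z *: w n.+1) -> forall n, w n = 0.
Proof.
move=> [A A0 wA] wz n; apply: rnorm0_eq0; apply/eqP.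
rewrite eq_le rnorm_ge0 andbT; apply/ler_addgt0Pr => e e0; rewrite add0r.
have [m H] := geometric_small (A * C ^+ n) q01 e0.
apply: le_trans (H m (leqnn m)).
have -> : w n = z ^+ m *: w (n + m)%N.
  elim: m {H} => [|m ->]; first by rewrite expr0 scale1r addn0.
  by rewrite wz scalerA -exprSr addnS.
rewrite rnormZ rnormXn exprMn mulrCA ler_wpM2l ?exprn_ge0 ?rnorm_ge0 //.
exact: tail_le.
Qed.

End Radius.

(** The resolvent identity
[(1 - z B)^-1 = (1 - z0 B)^-1 + (z - z0) (1 - z B)^-1 B (1 - z0 B)^-1]: the
injective operator [1 - z B] takes the same value on both sides. *)
Lemma tail_sums_resolvent C w z z0 : 0 <= C -> rnorm z * C < 1 -> rnorm z0 * C < 1 ->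
  geometric_growth C w -> forall n,
  tail_sums w z n =
    tail_sums w z0 n + (z - z0) *: tail_sums (fun m => tail_sums w z0 m.+1) z n.
Proof.
move=> C0 zC z0C wC n.
have psC v y : rnorm y * C < 1 -> geometric_growth C v ->
    geometric_growth C (tail_sums v y).
  move=> yC [A A0 vA]; exists (A / (1 - rnorm y * C)); last exact: tail_sums_le.
  by rewrite divr_ge0 // subr_ge0 ltW.
have shC v : geometric_growth C v -> geometric_growth C (fun m => v m.+1).
  move=> [A A0 vA]; exists (A * C); first by rewrite mulr_ge0.
  by move=> m; rewrite -mulrA -exprS.
set v := fun m => tail_sums w z0 m.+1.
have vC : geometric_growth C v by apply/shC/psC.
pose D m := tail_sums w z m - tail_sums w z0 m - (z - z0) *: tail_sums v z m.
suff D0 : forall m, D m = 0.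
  by move: (D0 n) => /eqP; rewrite subr_eq0 subr_eq addrC => /eqP.
apply: (backward_fixed_eq0 C0 zC).
  have [A1 A10 H1] := psC w z zC wC; have [A2 A20 H2] := psC w z0 z0C wC.
  have [A3 A30 H3] := psC v z zC vC.
  exists (A1 + A2 + rnorm (z - z0) * A3).
    by rewrite !addr_ge0 ?mulr_ge0 ?rnorm_ge0.
  move=> m; rewrite !mulrDl (le_trans (rnormB _ _)) // lerD //.
    by rewrite (le_trans (rnormB _ _)) // lerD.
  by rewrite rnormZ -mulrA ler_wpM2l ?rnorm_ge0.
move=> m; rewrite /D (tail_sumsS C0 zC wC m) (tail_sumsS C0 z0C wC m).
rewrite (tail_sumsS C0 zC vC m).
rewrite opprD addrACA subrr add0r -/(v m).
rewrite [in RHS]scalerBr [in RHS]scalerBr scalerDr !scalerA opprD addrA.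
by rewrite [z * (z - z0)]mulrC; congr (_ - _); rewrite scalerBl opprB addrA subrK.
Qed.

(** Iterating the resolvent identity at [z0] expands the sum in powers of
[z - z0] with an exact remainder, which replaces the rearrangement of a double
series by algebra.  Here [W k] is [(B (1 - z0 B)^-1) ^ k w], whose growth constant
gains a factor [C / d] at each step, and the remainder tends to [0] as soon as
[|z - z0| C <= d / 2]. *)
Lemma power_sum_analytic C w : 0 <= C -> geometric_growth C w ->
  analytic_on [set z | rnorm z * C < 1] (power_sum w).
Proof.
move=> C0 [A A0 wA] z0 /= z0C; pose d : R := 1 - rnorm z0 * C.
have d0 : 0 < d by rewrite subr_gt0.
pose W := fix W k := if k is k'.+1 then fun m => tail_sums (W k') z0 m.+1 else w.
have WA k n : rnorm (W k n) <= A * (C / d) ^+ k * C ^+ n.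
  elim: k n => [|k IHk] n; first by rewrite expr0 mulr1.
  have Ak0 : 0 <= A * (C / d) ^+ k by rewrite mulr_ge0 ?exprn_ge0 ?divr_ge0 // ltW.
  apply: (le_trans (tail_sums_le C0 z0C Ak0 IHk n.+1)); rewrite -/d.
  by rewrite !exprS le_eqVlt; apply/orP; left; apply/eqP; ring.
have WC k : geometric_growth C (W k).
  by exists (A * (C / d) ^+ k) => //; rewrite mulr_ge0 ?exprn_ge0 ?divr_ge0 // ltW.
exists (fun k => tail_sums (W k) z0 0%N).
have C10 : 0 < C + 1 by apply: ltr_wpDl.
apply/rnbhsP; exists (d / (2 * (C + 1))); first by rewrite divr_gt0 ?mulr_gt0.
move=> z zz0.
have zq : rnorm (z - z0) * C <= d / 2.
  apply: (@le_trans _ _ (rnorm (z - z0) * (C + 1))).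
    by rewrite ler_wpM2l ?rnorm_ge0 // lerDl.
  rewrite -ler_pdivlMr // rnorm_distC (le_trans (ltW zz0)) // le_eqVlt.
  by apply/orP; left; apply/eqP; field; rewrite lt0r_neq0.
have zC : rnorm z * C < 1.
  apply: (@le_lt_trans _ _ (rnorm z0 * C + d / 2)).
    rewrite -{1}[z](subrK z0) addrC (le_trans (ler_wpM2r C0 (rnormD _ _))) //.
    by rewrite mulrDl lerD.
  by rewrite -ltrBrDl -/d ltr_pdivrMr // ltr_pMr // ltr1n.
have expand n : power_sum w z =
    series (fun k => (z - z0) ^+ k *: tail_sums (W k) z0 0%N) n +
    (z - z0) ^+ n *: tail_sums (W n) z 0%N.
  elim: n => [|n IHn].
    by rewrite /series /= big_geq // add0r expr0 scale1r.
  rewrite {}IHn seriesSr (tail_sums_resolvent C0 zC z0C (WC n)) scalerDr addrA.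
  by rewrite scalerA -exprSr.
apply/rcvg_seqP => e e0; have half := @half_ge0_lt1 R.
have [n0 Hn] := geometric_small (A / (1 - rnorm z * C)) half e0.
exists n0 => n /Hn; apply: le_trans.
rewrite (expand n) [X in rnorm (X - _)]addrC addrK rnormZ rnormXn.
have An0 : 0 <= A * (C / d) ^+ n by rewrite mulr_ge0 ?exprn_ge0 ?divr_ge0 // ltW.
have := tail_sums_le C0 zC An0 (WA n) 0; rewrite expr0 mulr1.
move=> /(ler_wpM2l (exprn_ge0 n (rnorm_ge0 (z - z0)))) /le_trans; apply.
have -> : rnorm (z - z0) ^+ n * (A * (C / d) ^+ n / (1 - rnorm z * C)) =
    A / (1 - rnorm z * C) * (rnorm (z - z0) * C / d) ^+ n.
  by rewrite !exprMn; ring.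
apply: ler_wpM2l; first by rewrite divr_ge0 // subr_ge0 ltW.
apply: lerXn2r; rewrite ?nnegrE //.
  by rewrite divr_ge0 ?mulr_ge0 ?rnorm_ge0 // ltW.
by rewrite ler_pdivrMr // [leRHS]mulrC.
Qed.

End PowerSeries.

Section Disk.
Context {R : realType}.

Lemma disk_open (C : R) : open [set z : R[i] | rnorm z * C < 1].
Proof.
have [C0|C0] := lerP C 0.
  rewrite (_ : mkset _ = setT); first exact: openT.
  apply/seteqP; split => // z _ /=; apply: le_lt_trans (ltr01).
  by rewrite mulr_ge0_le0 ?rnorm_ge0.
rewrite openE => z /= zC; apply/rnbhsP; exists (C^-1 - rnorm z).
  by rewrite subr_gt0 -[C^-1]mul1r ltr_pdivlMr.
move=> y zy /=; rewrite -ltr_pdivlMr // mul1r -(subrK z y) addrC.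
by rewrite (le_lt_trans (rnormD _ _)) // addrC -ltrBrDr rnorm_distC.
Qed.

(** The disk is the union of the segments from [0] to its points. *)
Lemma disk_connected (C : R) : 0 <= C -> connected [set z : R[i] | rnorm z * C < 1].
Proof.
move=> C0; pose seg (w : R[i]) := (fun t : R => (t%:C)%C * w) @` `[0, 1].
have -> : [set z : R[i] | rnorm z * C < 1] =
    \bigcup_(w in [set z : R[i] | rnorm z * C < 1]) seg w.
  apply/seteqP; split => [z zC|z [w /= wC [t]]].
    by exists z => //; exists 1; rewrite ?mul1r //= in_itv /= ler01 lexx.
  rewrite /= in_itv /= => /andP[t0 t1] <-; apply: le_lt_trans wC.
  rewrite rnormM rnorm_real ger0_norm // ler_wpM2r // ler_piMl ?rnorm_ge0 //.
apply: bigcup_connected.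
  by exists 0 => w _; exists 0; rewrite ?mul0r //= in_itv /= ler01 lexx.
move=> w _; apply: connected_continuous_connected; first exact: segment_connected.
apply: continuous_subspaceT => t; apply/rcvgP => e e0.
have w0 : 0 < rnorm w + 1 by rewrite ltr_wpDl ?rnorm_ge0.
apply/nbhs_normP; exists (e / (rnorm w + 1)); first exact: divr_gt0.
move=> s /= ts; rewrite -mulrBl -rmorphB rnormM rnorm_real.
apply: (@le_trans _ _ (`|t - s| * (rnorm w + 1))).
  by rewrite ler_wpM2l // lerDl.
by rewrite -ler_pdivlMr // ltW.
Qed.

End Disk.

(** * The identity theorem *)

Section IdentityTheorem.
Context {R : realType} {Y : normedModType R[i]}.
Implicit Types (f : R[i] -> Y).

(** If [a m] is the first nonzero coefficient, then at a zero [z] of the sum the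
term of degree [m] is opposite to the tail, of order [|z - z0| ^ m.+1]; so
[|a m|] is at most a constant times [|z - z0|], which is as small as wanted. *)
Lemma power_series_coef_eq0 (a : nat -> Y) (z0 : R[i]) f :
  (\forall z \near z0, series (fun n => (z - z0) ^+ n *: a n) @ \oo --> f z) ->
  (forall e : R, 0 < e ->
     exists z, [/\ z != z0, rnorm (z - z0) < e & f z = 0]) ->
  forall n, a n = 0.
Proof.
move=> /rnbhsP[r0 r00 Hr] Hz.
have [z1 [z1z0 z1r _]] := Hz r0 r00.
pose r := rnorm (z1 - z0); have r_gt0 : 0 < r by rewrite rnorm_gt0 subr_eq0.
have [B B0 HB] : exists2 B : R, 0 <= B & forall k, r ^+ k * rnorm (a k) <= B.
  have Hcvg : cvgn (series (fun n => (z1 - z0) ^+ n *: a n)).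
    by apply: cvgP (Hr z1 _); rewrite rnorm_distC.
  have /cvgP Hc0 := cvg_series_cvg_0 Hcvg.
  have [B [_ HB]] := @cvg_seq_bounded _ (realified Y) _ Hc0.
  exists (`|B| + 1) => // k; rewrite /r -rnormXn -rnormZ.
  by apply: (HB (`|B| + 1)) => //; rewrite (le_lt_trans (ler_norm _)) // ltrDl.
move=> n; elim/ltn_ind: n => m IHm.
apply: rnorm0_eq0; apply/eqP; rewrite eq_le rnorm_ge0 andbT.
apply/ler_addgt0Pr => e e0; rewrite add0r.
have K0 : 0 < 2 * (B + 1) / r ^+ m.+1.
  by rewrite divr_gt0 ?exprn_gt0 ?mulr_gt0 ?ltr_wpDl.
pose d := Num.min r0 (Num.min (r / 2) (e / (2 * (B + 1) / r ^+ m.+1))).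
have d0 : 0 < d by rewrite /d !lt_min r00 (divr_gt0 e0 K0) divr_gt0.
have [z [zz0 zd fz]] := Hz d d0.
move: zd; rewrite /d !lt_min => /and3P[zr0 zr ze].
pose q := rnorm (z - z0) / r.
have z_gt0 : 0 < rnorm (z - z0) by rewrite rnorm_gt0 subr_eq0.
have q2 : q <= 2^-1 by rewrite ler_pdivrMr // mulrC ltW.
have q0 : 0 <= q by rewrite divr_ge0 // ltW.
have q01 : 0 <= q < 1.
  by rewrite q0 (le_lt_trans q2) // invf_lt1 ?ltr1n.
pose t k := (z - z0) ^+ k *: a k.
have tB k : rnorm (t k) <= B * q ^+ k.
  rewrite rnormZ rnormXn /q expr_div_n mulrCA ler_wpM2l ?exprn_ge0 ?rnorm_ge0 //.
  by rewrite ler_pdivlMr ?exprn_gt0 // mulrC.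
have st n : (m < n)%N -> series t n = t m + \sum_(m.+1 <= k < n) t k.
  move=> mn; rewrite /series /= (big_cat_nat (n := m)) // ?(ltnW mn) //=.
  rewrite big_nat big1 ?add0r; last by move=> k /andP[_ km]; rewrite /t IHm // scaler0.
  by rewrite big_ltn.
have tm : rnorm (t m) <= B * q ^+ m.+1 / (1 - q).
  apply/ler_addgt0Pr => e' e'0.
  have /rcvg_seqP/(_ e' e'0)[n0 Hn0] : series t @ \oo --> f z.
    by apply: Hr; rewrite rnorm_distC.
  have := Hn0 (maxn n0 m.+1) (leq_maxl _ _).
  rewrite fz sub0r rnormN (st _ (leq_maxr _ _)) => Hs.
  rewrite -[t m](addrK (\sum_(m.+1 <= k < maxn n0 m.+1) t k)) addrC.
  rewrite (le_trans (rnormD _ _)) // rnormN lerD //.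
  exact: series_geometric_le.
have : rnorm (t m) <= B * q ^+ m.+1 * 2.
  apply: (le_trans tm); apply: ler_wpM2l; first by rewrite mulr_ge0 ?exprn_ge0.
  rewrite -[2]invrK lef_pV2 ?posrE ?invr_gt0 // ?subr_gt0; last by case/andP: q01.
  by rewrite lerBrDr -lerBrDl (le_trans q2) // lerBrDl; lra.
rewrite rnormZ rnormXn.
have -> : B * q ^+ m.+1 * 2 = rnorm (z - z0) ^+ m *
    (rnorm (z - z0) * (2 * B / r ^+ m.+1)).
  by rewrite /q expr_div_n exprS; ring.
rewrite ler_pM2l ?exprn_gt0 // => /le_trans; apply.
move: ze; rewrite ltr_pdivlMr // => /ltW; apply: le_trans.
apply: ler_wpM2l; first exact: ltW.
apply: ler_wpM2r; first by rewrite invr_ge0 exprn_ge0 // ltW.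
by rewrite ler_wpM2l // lerDl.
Qed.

Lemma analytic_zeros_near (U : set R[i]) f z0 : analytic_on U f -> U z0 ->
  (forall e : R, 0 < e ->
     exists z, [/\ z != z0, rnorm (z - z0) < e & f z = 0]) ->
  \forall z \near z0, f z = 0.
Proof.
move=> fU Uz0 Hz; have [a Ha] := fU z0 Uz0.
have a0 := power_series_coef_eq0 Ha Hz.
move: Ha; apply: filterS => z Hs.
apply: (cvg_unique (@norm_hausdorff _ Y) Hs).
rewrite (_ : series _ = cst 0); first exact: cvg_cst.
by apply/funext => n; rewrite /series /= big1 // => k _; rewrite a0 scaler0.
Qed.

(** The interior of the zero set is open, and it is closed in [U] because the
zeros accumulate at each point of its closure. *)
Lemma identity_theorem (U : set R[i]) f l0 (r : R) : connected U ->
  analytic_on U f -> U l0 -> 0 < r ->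
  (forall z, z != l0 -> rnorm (z - l0) < r -> f z = 0) ->
  forall z, U z -> f z = 0.
Proof.
move=> Uc fU Ul0 r0 Hr; pose V : set R[i] := [set z | f z = 0]°.
have Vz z : V z -> f z = 0 by exact: (@interior_subset _ [set z | f z = 0]).
suff UV : U `&` V = U by move=> z; rewrite -UV => -[_ /Vz].
apply: Uc.
- exists l0; split => //; apply: (analytic_zeros_near fU) => // e e0.
  pose d := Num.min e r / 2.
  have d0 : 0 < d by rewrite divr_gt0 // lt_min e0 r0.
  have de : d < Num.min e r by rewrite ltr_pdivrMr // ltr_pMr ?ltr1n // lt_min e0 r0.
  have Hd : rnorm (l0 + (d%:C)%C - l0) = d.
    by rewrite addrAC subrr add0r rnorm_real gtr0_norm.
  move: de; rewrite lt_min -Hd => /andP[de dr].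
  exists (l0 + (d%:C)%C); split => //; last apply: Hr => //;
    by rewrite -subr_eq0 -rnorm_gt0 Hd.
- by exists V => //; exact: open_interior.
exists (closure V); first exact: closed_closure.
apply/seteqP; split => z [Uz]; first by move=> /subset_closure.
move=> clV; split => //; have [//|nVz] := pselect (V z).
apply: (analytic_zeros_near fU) => // e e0.
have [|y [Vy zy]] := clV [set y | rnorm (z - y) < e]; first by apply/rnbhsP; exists e.
exists y; split; [|by rewrite rnorm_distC|exact: Vz].
by apply/eqP => yz; apply: nVz; rewrite -yz.
Qed.

End IdentityTheorem.

(** * Backward orbits *)

Section BackwardOrbits.
Context {R : realType} {Y : completeNormedModType R[i]}.
Variables (S : {linear Y -> Y}) (Sc : continuous S).

Lemma power_sum_eigen (u : nat -> Y) (C : R) (z : R[i]) :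
  0 <= C -> geometric_growth C u -> rnorm z * C < 1 ->
  S (u 0%N) = 0 -> (forall n, S (u n.+1) = u n) ->
  S (power_sum u z) = z *: power_sum u z.
Proof.
move=> C0 uC zC Su0 Su; have ucvg := power_sum_cvg C0 zC uC.
have Scvg : S \o series (fun k => z ^+ k *: u k) @ \oo --> S (power_sum u z).
  by apply: continuous_cvg => //; exact: Sc.
apply: (cvg_unique (@norm_hausdorff _ Y) Scvg) => /=; move: Scvg => _.
suff : [sequence (S \o series (fun k => z ^+ k *: u k)) n.+1]_n @ \oo
    --> z *: power_sum u z by rewrite cvg_shiftS.
rewrite (_ : [sequence _]_n = (fun n => z *: series (fun k => z ^+ k *: u k) n)).
  exact: cvgZl_tmp.
apply/funext => n /=; rewrite !seriesEord /= big_ord_recl linearD linearZ /= Su0.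
rewrite scaler0 add0r linear_sum scaler_sumr; apply: eq_bigr => i _.
by rewrite linearZ /= Su scalerA -exprS.
Qed.

(** The kernel of each power of [S] lies in the range, so the preimages can be
chosen forever: [u n] is killed by [S^(n+1)].  Choosing each with the bound of
the open mapping theorem keeps the growth geometric. *)
Lemma backward_orbit x : semi_regular S -> S x = 0 ->
  exists2 C : R, 0 < C & exists u : nat -> Y, [/\ u 0%N = x,
    forall n, S (u n.+1) = u n & forall n, rnorm (u n.+1) <= C * rnorm (u n)].
Proof.
move=> [Scl Sker] Sx; have [C C0 HC] := closed_range_preimage Sc Scl.
exists C => //.
have /choice[s Hs] : forall y, exists z, range S y ->
    S z = y /\ rnorm z <= C * rnorm y.
  move=> y; have [Sy|nSy] := pselect (range S y); last by exists 0 => /nSy.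
  by have [z Sz zy] := HC y Sy; exists z.
pose u n := iter n s x.
have Sun n : iter n.+1 S (u n) = 0.
  elim: n => [//|n IHn]; rewrite iterSr.
  by rewrite (Hs (u n) _).1 //; apply: (Sker n.+1).
have uR n : range S (u n) by apply: (Sker n.+1); exact: Sun.
by exists u; split => // n; have [] := Hs _ (uR n).
Qed.

Lemma orbit_growth (u : nat -> Y) (C : R) : 0 <= C ->
  (forall n, rnorm (u n.+1) <= C * rnorm (u n)) ->
  forall n k, rnorm (u (n + k)%N) <= rnorm (u n) * C ^+ k.
Proof.
move=> C0 uC n; elim=> [|k IHk]; first by rewrite addn0 expr0 mulr1.
by rewrite addnS exprS mulrCA (le_trans (uC _)) // ler_wpM2l.
Qed.

(** A backward orbit from a nonzero kernel vector yields an analytic family of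
eigenvectors whose value at [0] is that vector. *)
Lemma semi_regular_SVEP_injective :
  semi_regular S -> SVEP_at S 0 -> injective S.
Proof.
move=> Ssr Ssvep; suff S0 x : S x = 0 -> x = 0.
  move=> x y Sxy; apply/eqP; rewrite -subr_eq0; apply/eqP/S0.
  by rewrite linearB Sxy subrr.
move=> Sx; have [C C0 [u [u0 Su uC]]] := backward_orbit Ssr Sx.
have ub : geometric_growth C u.
  exists (rnorm x); first exact: rnorm_ge0.
  by move=> n; rewrite -u0; exact: (orbit_growth (ltW C0) uC 0 n).
have disk0 : rnorm (0 : R[i]) * C < 1 by rewrite rnorm0 mul0r.
have fan := power_sum_analytic (ltW C0) ub.
have : power_sum u 0 = 0.
  apply: (Ssvep _ (@disk_open _ C) (disk_connected (ltW C0)) _ _ fan) => // l lC.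
  by rewrite (power_sum_eigen (ltW C0) ub lC) ?subrr // u0.
have := tail_sumsS (ltW C0) disk0 ub 0%N; rewrite scale0r addr0 u0 /tail_sums.
by rewrite (_ : (fun k => u (0 + k)%N) = u) // => ->.
Qed.

(** For [z <> 0] the sum [f(z)] of the power series lies in [A], hence in the
quasinilpotent part, but satisfies [S f(z) = z f(z)]; so [f(z) = 0].  Letting
[z] tend to [0] gives [u 0 = 0]. *)
Lemma backward_orbit_eq0 (A : set Y) (u : nat -> Y) (C : R) : 0 < C ->
  S (u 0%N) = 0 -> (forall n, S (u n.+1) = u n) ->
  (forall n, rnorm (u n.+1) <= C * rnorm (u n)) ->
  closed A -> A `<=` quasinilpotent_part S ->
  (forall z n, A (series (fun k => z ^+ k *: u k) n)) -> u 0%N = 0.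
Proof.
move=> C0 Su0 Su uC cA AH Au; have ub := orbit_growth (ltW C0) uC.
have uG : geometric_growth C u.
  by exists (rnorm (u 0%N)); [exact: rnorm_ge0|exact: (ub 0%N)].
have shG : geometric_growth C (fun k => u (1 + k)%N).
  by exists (rnorm (u 1%N)); [exact: rnorm_ge0|exact: (ub 1%N)].
apply: rnorm0_eq0; apply/eqP; rewrite eq_le rnorm_ge0 andbT.
apply/ler_addgt0Pr => e e0; rewrite add0r.
(* B bounds the sum of the series for |z| C <= 1 / 2 with its first term
   removed and divided by z; the summand 1 keeps it positive. *)
pose B := 2 * rnorm (u 1%N) + 1.
have B0 : 0 < B by rewrite ltr_wpDl // mulr_ge0 ?rnorm_ge0.
pose t := Num.min (C^-1 / 2) (e / B).
have t0 : 0 < t by rewrite lt_min !divr_gt0 ?invr_gt0.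
pose z : R[i] := (t%:C)%C.
have zt : rnorm z = t by rewrite rnorm_real gtr0_norm.
have zC2 : rnorm z * C <= 2^-1.
  by rewrite zt -ler_pdivlMr // mulrC ge_min lexx.
have zC : rnorm z * C < 1 by rewrite (le_lt_trans zC2) // invf_lt1 ?ltr1n.
have f0 : power_sum u z = 0.
  apply: (@quasinilpotent_part_eigen _ _ S _ z); first by rewrite -rnorm_gt0 zt.
    exact: (power_sum_eigen (ltW C0)).
  by apply: AH; apply: closed_seq cA (Au z) (power_sum_cvg (ltW C0) zC uG).
have := tail_sumsS (ltW C0) zC uG 0%N.
rewrite /tail_sums (_ : (fun k => u (0 + k)%N) = u) //.
rewrite f0 => /esym/eqP; rewrite addr_eq0 => /eqP ->.
rewrite rnormN rnormZ zt.
have := power_sum_le (ltW C0) zC (rnorm_ge0 _) (ub 1%N).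
move=> /(ler_wpM2l (ltW t0)) /le_trans; apply.
apply: (@le_trans _ _ (t * B)); last by rewrite -ler_pdivlMr // ge_min lexx orbT.
apply: ler_wpM2l; first exact: ltW.
rewrite ler_pdivrMr ?subr_gt0 //; rewrite /B.
by have := rnorm_ge0 (u 1%N); nra.
Qed.

End BackwardOrbits.

Section RestrictedSVEP.
Context {R : realType} {X : normedModType R[i]}.

Lemma SVEP_restr (T : {linear X -> X}) (M : submodClosed X) l0 :
  invariant_subspace T M -> SVEP_at T l0 -> SVEP_at (restr_op T M) l0.
Proof.
move=> MT Tsvep U Uo Uc Ul f fU Tf l Ul'; apply: val_inj.
apply: (Tsvep U Uo Uc Ul (fun z => val (f z))) => // [z0 Uz0|z Uz]; last first.
  by rewrite -val_restr // -linearZ -linearB Tf.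
have [a Ha] := fU z0 Uz0; exists (fun n => val (a n)); move: Ha.
have sumE z n : series (fun k => (z - z0) ^+ k *: val (a k)) n =
    val (series (fun k => (z - z0) ^+ k *: a k) n).
  elim: n => [|n IHn]; last by rewrite !seriesSr IHn.
  by rewrite /series /= !big_geq.
by apply: filterS => z /rcvgP Hs; apply/rcvgP => e /Hs; apply: filterS => n; rewrite sumE.
Qed.

End RestrictedSVEP.

(** * Operators with a generalized Kato decomposition *)

Section BoundedBelow.
Context {R : realType} {Y : completeNormedModType R[i]}.
Variables (S : {linear Y -> Y}) (Sc : continuous S).

Lemma injective_bounded_below : closed (range S) -> injective S ->
  exists2 c : R, 0 < c & forall x, c * rnorm x <= rnorm (S x).
Proof.
move=> Scl Sinj; have [C C0 HC] := closed_range_preimage Sc Scl.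
exists C^-1 => [|x]; first by rewrite invr_gt0.
rewrite ler_pdivrMl //; have [|y Syx] := HC (S x); first by exists x.
by rewrite (Sinj _ _ Syx).
Qed.

Lemma injective_quasinilpotent_part_eq0 x : closed (range S) -> injective S ->
  quasinilpotent_part S x -> x = 0.
Proof.
move=> Scl Sinj; have [c c0 Hc] := injective_bounded_below Scl Sinj.
apply: (quasinilpotent_part_eq0 c0); elim=> [|n IHn].
  by rewrite expr0 mul1r.
rewrite iterS exprS -mulrA; apply: le_trans (Hc _).
by rewrite ler_pM2l.
Qed.

End BoundedBelow.

Section AnalyticalCore.
Context {R : realType} {X : normedModType R[i]}.
Variable T : {linear X -> X}.

(** The definition of the core has no room for the constant [B], but as
[w 0 <> 0] it can be absorbed by enlarging the ratio; when [w 0 = 0] the zero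
orbit is a witness. *)
Lemma analytical_core_geometric (w : nat -> X) (B C : R) : 0 <= B -> 0 < C ->
  (forall n, T (w n.+1) = w n) -> (forall n, rnorm (w n) <= B * C ^+ n) ->
  analytical_core T (w 0%N).
Proof.
move=> B0 C0 Tw wB; have [->|w0] := eqVneq (w 0%N) 0.
  exists (cst 0), 1; split => //= [|n _|n _]; rewrite ?linear0 //.
  by rewrite rnorm0 mulr0.
have nw : 0 < rnorm (w 0%N) by rewrite rnorm_gt0.
pose b := B / rnorm (w 0%N).
have b0 : 0 <= b by rewrite divr_ge0 // ltW.
exists w, (C * (1 + b)); split; [|exact: Tw|by move=> n _; exact: Tw|].
  by rewrite mulr_gt0 // ltr_pwDl.
move=> [//|n] _.
apply: (le_trans (wB _)); rewrite exprMn mulrC -mulrA ler_pM2l ?exprn_gt0 //.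
rewrite -ler_pdivrMr // -/b (@le_trans _ _ (1 + b)) ?lerDr //.
by rewrite exprS ler_pMr ?ltr_pwDl // exprn_ege1 // lerDl.
Qed.

(** The backward orbit of [x] stays in the quasinilpotent part.  Its growth
[d ^ n] is beaten by the bound [(2 d) ^ - n] on the iterates, so that
[|x| <= |x| / 2]. *)
Lemma quasinilpotent_core_eq0 x :
  (forall e : R, 0 < e -> exists n0, forall n, (n0 <= n)%N -> forall y,
     quasinilpotent_part T y -> rnorm (iter n T y) <= e ^+ n * rnorm y) ->
  analytical_core T x -> quasinilpotent_part T x -> x = 0.
Proof.
move=> Hunif [u [d [d0 Tu1 Tu ud]]] xH.
have uH n : quasinilpotent_part T (u n.+1).
  by elim: n => [|n IHn]; apply: quasinilpotent_part_image; rewrite ?Tu1 ?Tu.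
have Tnu n : iter n.+1 T (u n.+1) = x.
  by elim: n => [//|n IHn]; rewrite iterSr Tu.
have [|n0 Hn0] := Hunif ((2 * d)^-1); first by rewrite invr_gt0 mulr_gt0.
have := Hn0 n0.+1 (leqnSn _) _ (uH n0); rewrite Tnu => Hx.
have {Hx} : rnorm x <= 2^-1 * rnorm x.
  apply: (le_trans Hx); have := ud n0.+1 isT.
  move=> /(ler_wpM2l (exprn_ge0 n0.+1 (ltW _))) H.
  apply: (le_trans (H (2 * d)^-1 _)); first by rewrite invr_gt0 mulr_gt0.
  rewrite mulrA -exprMn invfM -mulrA mulVf ?lt0r_neq0 // mulr1.
  rewrite ler_wpM2r ?rnorm_ge0 // exprS ler_piMr ?invr_ge0 //.
  by rewrite exprn_ile1 // ?invr_ge0 // invf_le1 // ler1n.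
move=> Hx; apply: rnorm0_eq0; have := rnorm_ge0 x; lra.
Qed.

End AnalyticalCore.

Section Kato.
Context {R : realType} {X : completeNormedModType R[i]}.
Variables (T : {linear X -> X}) (Tc : continuous T).

Lemma quasinilpotent_part_restr (M : submodClosed X) (x : subspace_type M) :
  invariant_subspace T M ->
  quasinilpotent_part (restr_op T M) x <-> quasinilpotent_part T (val x).
Proof.
move=> MT; rewrite !quasinilpotent_partP.
have E n : rnorm (iter n (restr_op T M) x) = rnorm (iter n T (val x)).
  by rewrite -val_iter_restr.
by split=> H e /H[n0 Hn]; exists n0 => n /Hn; rewrite E.
Qed.

Section Decomposition.
Variables (M N : submodClosed X) (G : GKD T M N).

Let cM : closed_subspace M. Proof. by case: G => -[]. Qed.
Let MT : invariant_subspace T M. Proof. by case: G => _ _ []. Qed.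
Let NT : invariant_subspace T N. Proof. by case: G => _ _ []. Qed.

Let SM : {linear closed_subspace_type cM -> closed_subspace_type cM} := restr_lin MT.

Let SMc : continuous SM.
Proof. exact: restr_continuous. Qed.

Let SMcl : closed (range SM).
Proof. by case: G => _ _ _ []. Qed.

Lemma GKD_uniform (e : R) : 0 < e -> exists n0, forall n, (n0 <= n)%N ->
  forall x, x \in N -> rnorm (iter n T x) <= e ^+ n * rnorm x.
Proof.
move=> e0; have qN : quasinilpotent (restr_lin NT) by case: G.
have Sc : continuous (restr_lin NT) by exact: restr_continuous.
have [n0 Hn] := (quasinilpotentP Sc).1 qN e e0.
exists n0 => n n0n x xN; have := Hn n n0n (SubspaceType xN).
by rewrite {1}/rnorm /Num.norm /= val_iter_restr.
Qed.

Lemma GKD_sub_quasinilpotent_part : [set x | x \in N] `<=` quasinilpotent_part T.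
Proof.
move=> x /= xN; apply/quasinilpotent_partP => e e0.
have [|n1 H1] := GKD_uniform (e := e / 2); first exact: divr_gt0.
have half := @half_ge0_lt1 R.
have [n2 H2] := geometric_small (rnorm x) half ltr01.
exists (maxn n1 n2) => n; rewrite geq_max => /andP[n1n n2n].
apply: (le_trans (H1 n n1n x xN)).
rewrite exprMn mulrAC -mulrA ler_piMr ?(H2 n n2n) //.
by rewrite exprn_ge0 // ltW.
Qed.

(** The component in [M] of a vector of [H0] is also in [H0], where a bounded
below operator has no nonzero vector. *)
Lemma GKD_quasinilpotent_part_eq :
  injective (restr_op T M) -> quasinilpotent_part T = [set x | x \in N].
Proof.
move=> Minj; apply/seteqP; split; last exact: GKD_sub_quasinilpotent_part.
move=> x xH; have [_ [dec _] _ _ _] := G; have [a [b [/= aM bN xab]]] := dec x.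
have bH := GKD_sub_quasinilpotent_part bN.
have aH : quasinilpotent_part T a.
  have -> : a = (-1) *: b + x by rewrite xab scaleN1r addrC addrK.
  exact: quasinilpotent_partZD.
have a0 : (SubspaceType aM : closed_subspace_type cM) = 0.
  apply: (injective_quasinilpotent_part_eq0 SMc SMcl Minj).
  by apply/(@quasinilpotent_part_restr M (SubspaceType aM) MT).
by rewrite xab; move/(congr1 val): a0 => /= ->; rewrite add0r.
Qed.

Lemma GKD_core_disjoint : injective (restr_op T M) ->
  analytical_core T `&` quasinilpotent_part T = [set 0].
Proof.
move=> Minj; apply/seteqP; split => [x [xK xH]|_ ->].
  apply: (quasinilpotent_core_eq0 _ xK xH) => e e0.
  have [n0 Hn] := GKD_uniform e0; exists n0 => n /Hn H y.
  by rewrite (GKD_quasinilpotent_part_eq Minj); exact: H.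
split; last exact: quasinilpotent_part0.
by apply: (@analytical_core_geometric _ _ T (cst 0) 0 1) => //= n;
  rewrite ?linear0 ?rnorm0 ?mul0r.
Qed.

(** The identity [T f(l) = l f(l)] splits along the direct sum.  For
[0 < |l| < c] the component in [M] contradicts [c |a| <= |T a|] unless it is
zero, and the one in [N] is an eigenvector in [H0]. *)
Lemma GKD_injective_SVEP : injective (restr_op T M) -> SVEP_at T 0.
Proof.
move=> Minj U Uo Uc U0 f fU Tf.
have [c c0 Hc] := injective_bounded_below SMc SMcl Minj.
have /rnbhsP[r r0 rU] : nbhs (0 : R[i]) U by exact: open_nbhs_nbhs.
apply: (identity_theorem (l0 := 0) (r := Num.min r c) Uc fU U0).
  by rewrite lt_min r0.
move=> l l0; rewrite subr0 lt_min => /andP[lr lc].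
have Ul : U l by apply: rU; rewrite sub0r rnormN.
have [_ [dec dis] _ _ _] := G; have [a [b [/= aM bN fab]]] := dec (f l).
have ab : T a - l *: a = l *: b - T b.
  have := Tf l Ul; rewrite fab scalerDr [T _]linearD opprD addrACA addrC.
  by move/eqP; rewrite addr_eq0 opprB => /eqP.
have Ta : T a - l *: a = 0.
  have : ([set x | x \in M] `&` [set x | x \in N]) (T a - l *: a).
    split; first by rewrite /= -scaleNr rpredD ?rpredZ //; exact: MT.
    by rewrite ab /= -scaleN1r rpredD ?rpredZ //; exact: NT.
  by rewrite dis.
have b0 : b = 0.
  apply: (quasinilpotent_part_eigen l0 _ (GKD_sub_quasinilpotent_part bN)).
  by apply/eqP; rewrite eq_sym -subr_eq0 -ab Ta.
have a0 : a = 0.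
  have := Hc (SubspaceType aM : closed_subspace_type cM).
  have -> : rnorm (SM (SubspaceType aM)) = rnorm (T a).
    by rewrite -[in RHS](val_restr MT (SubspaceType aM)).
  move/eqP : Ta; rewrite subr_eq0 => /eqP ->; rewrite rnormZ => H.
  apply/eqP; apply: contraTT lc; rewrite -rnorm_gt0 -leNgt => na.
  by rewrite -(ler_pM2r na).
by rewrite fab a0 b0 addr0.
Qed.

Lemma GKD_SVEP_injective : SVEP_at (restr_op T M) 0 -> injective (restr_op T M).
Proof.
move=> Hs; apply: (semi_regular_SVEP_injective SMc _ Hs); by case: G.
Qed.

(** Common to the closedness of [H0] and to that of its intersection with [K]:
any closed [A] inside [H0] that captures the partial sums of the power series
along backward orbits forces [T_M] to be injective. *)
Lemma GKD_orbit_injective (A : set X) : closed A ->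
  A `<=` quasinilpotent_part T ->
  (forall (u : nat -> X) (C : R), 0 < C -> T (u 0%N) = 0 ->
     (forall n, T (u n.+1) = u n) ->
     (forall n, rnorm (u n.+1) <= C * rnorm (u n)) ->
     forall z n, A (series (fun k => z ^+ k *: u k) n)) ->
  injective (restr_op T M).
Proof.
move=> cA AH HA; suff S0 (x : subspace_type M) : SM x = 0 -> x = 0.
  move=> x y Sxy; apply/eqP; rewrite -subr_eq0; apply/eqP/S0.
  by rewrite linearB /= Sxy subrr.
have sr : semi_regular SM by case: G.
move=> Sx; have [C C0 [u [u0 Su uC]]] := backward_orbit SMc sr Sx.
apply: val_inj; rewrite -u0.
have Tu0 : T (val (u 0%N : subspace_type M)) = 0.
  by rewrite -val_restr // u0 [restr_op T M x]Sx.
have Tu n : T (val (u n.+1 : subspace_type M)) = val (u n : subspace_type M).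
  by rewrite -val_restr //; congr val; exact: Su.
apply: (backward_orbit_eq0 Tc C0 Tu0 Tu _ cA AH) => //.
exact: (HA _ C).
Qed.

Lemma orbit_sum_quasinilpotent (u : nat -> X) : T (u 0%N) = 0 ->
  (forall n, T (u n.+1) = u n) ->
  forall (z : R[i]) n, quasinilpotent_part T (series (fun k => z ^+ k *: u k) n).
Proof.
move=> Tu0 Tu z; have uH n : quasinilpotent_part T (u n).
  elim: n => [|n IHn]; apply: quasinilpotent_part_image; rewrite ?Tu0 ?Tu //.
  exact: quasinilpotent_part0.
elim=> [|n IHn]; last by rewrite seriesS; exact: quasinilpotent_partZD.
by rewrite /series /= big_geq //; exact: quasinilpotent_part0.
Qed.

(** The sums of the shifted orbits form a backward orbit of the sum. *)
Lemma orbit_sum_core (u : nat -> X) (C : R) : 0 < C ->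
  (forall n, T (u n.+1) = u n) ->
  (forall n, rnorm (u n.+1) <= C * rnorm (u n)) ->
  forall (z : R[i]) n, analytical_core T (series (fun k => z ^+ k *: u k) n).
Proof.
move=> C0 Tu uC z n; have ub := orbit_growth (ltW C0) uC.
pose w m := \sum_(0 <= k < n) z ^+ k *: u (k + m)%N.
have -> : series (fun k => z ^+ k *: u k) n = w 0%N.
  by rewrite /series /=; apply: eq_bigr => k _; rewrite addn0.
apply: (@analytical_core_geometric _ _ T w
  (\sum_(0 <= k < n) rnorm (z ^+ k) * rnorm (u k)) C) => // [|m|m].
- by apply: sumr_ge0 => k _; rewrite mulr_ge0 ?rnorm_ge0.
- rewrite /w linear_sum; apply: eq_bigr => k _.
  by rewrite linearZ /= addnS Tu.
apply: (le_trans (rnorm_sum _ _ _)); rewrite mulr_suml; apply: ler_sum => k _.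
by rewrite rnormZ -mulrA ler_wpM2l ?rnorm_ge0.
Qed.

Lemma GKD_equivalences :
     [<-> SVEP_at T 0;
          SVEP_at (restr_op T M) 0;
          injective (restr_op T M);
          quasinilpotent_part T = [set x | x \in N];
          closed (quasinilpotent_part T);
          analytical_core T `&` quasinilpotent_part T = [set 0];
          closed (analytical_core T `&` quasinilpotent_part T)].
Proof.
have cN : closed_subspace N by case: G => -[].
tfae.
- exact: SVEP_restr.
- exact: GKD_SVEP_injective.
- exact: GKD_quasinilpotent_part_eq.
- by move=> ->.
- move=> cH; apply: GKD_core_disjoint; apply: (GKD_orbit_injective cH) => //.
  by move=> u C C0 Tu0 Tu uC; exact: orbit_sum_quasinilpotent.
- move=> ->; apply/rclosedP => x Hx /=; apply: rnorm0_eq0; apply/eqP.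
  rewrite eq_le rnorm_ge0 andbT; apply/ler_addgt0Pr => e /Hx[_ ->].
  by rewrite subr0 add0r => /ltW.
move=> cKH; apply: GKD_injective_SVEP; apply: (GKD_orbit_injective cKH).
  by move=> x [].
move=> u C C0 Tu0 Tu uC z n; split; first exact: (orbit_sum_core C0).
exact: orbit_sum_quasinilpotent.
Qed.

Lemma GKD_left_gDrazin : quasinilpotent_part T = [set x | x \in N] ->
  left_gDrazin_invertible T.
Proof.
move=> HN; have [[_ cN] dsum _ _ _] := G; split; first by rewrite HN.
exists M; split => //; first by rewrite HN.
apply/rclosedP => y Hy.
have yM : y \in M.
  move/rclosedP : cM => /(_ y); apply => e /Hy[_ [x /= xM <-] yx].
  by exists (T x) => //; exact: MT.
have /rclosedP/(_ (SubspaceType yM : closed_subspace_type cM)) := SMcl.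
case=> [e /Hy[_ [x /= xM <-] yx]|x _ Sx].
  exists (SM (SubspaceType xM)); first by exists (SubspaceType xM).
  by move: yx; rewrite -(val_restr MT (SubspaceType xM)).
exists (val (x : subspace_type M)); first by case: (x : subspace_type M).
by rewrite -val_restr // [restr_op T M x]Sx.
Qed.

End Decomposition.

(** The decomposition is [(M, H0)].  Kernels of powers of [T_M] lie in the
intersection of [M] and [H0], so they are trivial, and quasinilpotence on [H0]
is uniform boundedness on that Banach space. *)
Lemma left_gDrazin_GKD : left_gDrazin_invertible T ->
  exists M N, GKD T M N /\ quasinilpotent_part T = [set x | x \in N].
Proof.
move=> [cH [M [cM dsum MT cTM]]].
pose N := subspace_of (@quasinilpotent_part0 _ _ T) (@quasinilpotent_partZD _ _ T).
have NE : [set x | x \in N] = quasinilpotent_part T.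
  exact: mem_subspace_of.
have NH x : x \in N <-> quasinilpotent_part T x by rewrite -NE.
have NT : invariant_subspace T N.
  move=> x /NH/quasinilpotent_partP Hx; apply/NH/quasinilpotent_partP => e e0.
  have [|n1 H1] := Hx (e / 2); first exact: divr_gt0.
  have half := @half_ge0_lt1 R.
  have [n2 H2] := geometric_small (e / 2) half ltr01.
  exists (maxn n1 n2) => n; rewrite geq_max => /andP[n1n n2n].
  rewrite -iterSr; apply: (le_trans (H1 n.+1 (leqW n1n))).
  rewrite exprS exprMn mulrCA ler_piMr ?(H2 n n2n) //.
  by rewrite exprn_ge0 // ltW.
have cN : closed_subspace N by rewrite /closed_subspace NE.
exists M, N; split => //; split => //; first by rewrite NE.
  split.
    apply/rclosedP => y Hy.
    have [x /= xM Txy] : (T @` [set x | x \in M]) (val y).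
      move/rclosedP : cTM; apply => e /Hy[_ [x _ <-] yx].
      exists (T (val x)); first by exists (val x) => //; case: x {yx}.
      by rewrite -val_restr.
    by exists (SubspaceType xM) => //; apply: val_inj; rewrite val_restr.
  move=> n x /= Tnx.
  have Tnx0 : iter n T (val x) = 0 by rewrite -val_iter_restr // Tnx.
  have xH : quasinilpotent_part T (val x).
    apply/quasinilpotent_partP => e e0; exists n => m nm.
    by rewrite -(subnK nm) iterD Tnx0 iter_linear0 rnorm0 exprn_ge0 // ltW.
  have : ([set x | x \in M] `&` quasinilpotent_part T) (val x).
    by split => //; case: (x).
  rewrite dsum.2 => x0; exists 0 => //; apply: val_inj.
  by rewrite val_restr // x0 linear0.
apply: (@locally_quasinilpotent _ (closed_subspace_type cN) (restr_lin NT)).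
  exact: restr_continuous.
move=> x; apply/(@quasinilpotent_part_restr N x NT).
by apply/NH; case: (x : subspace_type N).
Qed.

End Kato.

(** * Left generalized Drazin invertibility *)

Theorem theorem3p3 (R : realType) (X : completeNormedModType R[i])
  (Xinf : infinite_dimensional X) (T : {linear X -> X}) (Tc : continuous T) :
  (forall M N : submodClosed X, GKD T M N ->
     [<-> SVEP_at T 0;
          SVEP_at (restr_op T M) 0;
          injective (restr_op T M);
          quasinilpotent_part T = [set x | x \in N];
          closed (quasinilpotent_part T);
          analytical_core T `&` quasinilpotent_part T = [set 0];
          closed (analytical_core T `&` quasinilpotent_part T)]) /\
  (left_gDrazin_invertible T <->
   exists M N : submodClosed X, GKD T M N /\
     (SVEP_at T 0 \/
      SVEP_at (restr_op T M) 0 \/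
      injective (restr_op T M) \/
      quasinilpotent_part T = [set x | x \in N] \/
      closed (quasinilpotent_part T) \/
      analytical_core T `&` quasinilpotent_part T = [set 0] \/
      closed (analytical_core T `&` quasinilpotent_part T))).
Proof.
split=> [M N G|]; first exact: GKD_equivalences.
split=> [/(left_gDrazin_GKD Tc)[M [N [G HN]]]|[M [N [G H]]]].
  by exists M, N; split => //; do 3 right; left.
have E := GKD_equivalences Tc G.
apply: (GKD_left_gDrazin G).
by case: H => [/(E 0 3)|[/(E 1 3)|[/(E 2 3)|[//|[/(E 4 3)|[/(E 5 3)|/(E 6 3)]]]]]].
Qed.
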